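(* Let $m,n,p\in\mathbb{N}$. The moduli space $\mathrm{sys}^{cc}_{m,n,p}$ of completely controllable systems of type $(m,n,p)$ has a cell decomposition identical to the natural cell decomposition of a vector bundle of rank $(p+1)n$ on the Grassmannian $\mathrm{Gras}_n(m+n-1)$ with respect to the Schubert cells on the Grassmannian.
   Context: A linear control system of type $(m,n,p)$ is a triple $\Sigma=(A,B,C)\in V_{m,n,p}=M_n(\mathbb{C})\times M_{n\times m}(\mathbb{C})\times M_{p\times n}(\mathbb{C})$. The group $GL_n=GL_n(\mathbb{C})$ acts by $g.(A,B,C)=(gAg^{-1},gB,Cg^{-1})$. $\Sigma$ is completely controllable if the matrix $c(\Sigma)=[\,B\ AB\ A^2B\ \cdots\ A^{n-1}B\,]$ has maximal rank $n$. The completely controllable systems form a $GL_n$-stable open subset $V^{cc}_{m,n,p}$ on which $GL_n$ acts with trivial stabilizers, and $\mathrm{sys}^{cc}_{m,n,p}=V^{cc}_{m,n,p}/GL_n$ is the orbit space, a smooth quasi-projective variety of dimension $(m+p)n$. $\mathrm{Gras}_n(N)$ is the Grassmannian of $n$-dimensional subspaces of $\mathbb{C}^N$, with its decomposition into Schubert cells $S_I$ indexed by the $n$-element subsets $I\subset\{1,\ldots,N\}$, each isomorphic to an affine space. The natural cell decomposition of a rank $r$ vector bundle over $\mathrm{Gras}_n(N)$ consists of the restrictions of the bundle to the Schubert cells, which are affine spaces of dimension $\dim S_I+r$. A cell decomposition of a variety is a finite partition into locally closed subvarieties isomorphic to affine spaces; two cell decompositions are identical if there is a dimension-preserving bijection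 between their sets of cells. *)

(* Defs.v *)
(* Complex varieties are represented by their spaces of
   closed points: a topological space together with, for every open set U, the
   functions that are regular on U ("spaces with functions", as in Kempf,
   Algebraic Varieties).  Open and locally closed subvarieties, products and
   geometric quotients are computed in this category as they are for
   varieties. *)
From HB Require Import structures.
From mathcomp Require Export all_boot all_order all_algebra.
From mathcomp Require Export all_classical reals.
From mathcomp Require Export topology_structure initial_topology.
From mathcomp.real_closed Require Export complex.
From mathcomp.multinomials Require Export mpoly.

Set Implicit Arguments.
Unset Strict Implicit.
Unset Printing Implicit Defensive.

Import GRing.Theory.
Local Open Scope classical_set_scope.
Local Open Scope ring_scope.

(* [regular U f] only depends on the restriction of f to U, and is only
   meaningful for U open. *)
Record fspace (F : fieldType) := FSpace {
  fs_top :> topologicalType;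
  regular : set fs_top -> (fs_top -> F) -> Prop;
  regular_sub : forall (U V : set fs_top) (f g : fs_top -> F),
    open V -> V `<=` U -> (forall x, V x -> f x = g x) ->
    regular U f -> regular V g;
  regular_glue : forall (U : set fs_top) (f : fs_top -> F), open U ->
    (forall x, U x -> exists2 V, open V /\ V x & regular V f) -> regular U f;
  regular_cst : forall (U : set fs_top) (c : F),
    open U -> regular U (fun=> c);
  regularD : forall (U : set fs_top) (f g : fs_top -> F), open U ->
    regular U f -> regular U g -> regular U (fun x => f x + g x);
  regularM : forall (U : set fs_top) (f g : fs_top -> F), open U ->
    regular U f -> regular U g -> regular U (fun x => f x * g x);
  regular_nz : forall (U : set fs_top) (f : fs_top -> F), open U ->
    regular U f -> open (U `&` [set x | f x != 0]);
  regularV : forall (U : set fs_top) (f : fs_top -> F), open U ->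
    regular U f -> regular (U `&` [set x | f x != 0]) (fun x => (f x)^-1)
}.

Section Morphisms.
Context {F : fieldType}.

Definition fs_morphism (X Y : fspace F) (phi : X -> Y) : Prop :=
  (forall V : set Y, open V -> open (phi @^-1` V)) /\
  (forall (V : set Y) (g : Y -> F), open V -> regular V g ->
     regular (phi @^-1` V) (g \o phi)).

Definition fs_isomorphism (X Y : fspace F) (phi : X -> Y) : Prop :=
  fs_morphism phi /\
  exists psi : Y -> X, [/\ fs_morphism psi, cancel phi psi & cancel psi phi].

Definition fs_isomorphic (X Y : fspace F) : Prop :=
  exists phi : X -> Y, fs_isomorphism phi.

End Morphisms.

Definition classic_choice (T : Type) : choiceType :=
  HB.pack T (gen_eqMixin T) (gen_choiceMixin T).

(* The structure generated by a family of local functions: [L D h] says that h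
   is one of the given functions on D.  The sets D `&` [h != 0] form a base of
   the topology, and the regular functions are those locally of the form g/h
   with g, h in the family and h nowhere zero. *)
Section LocalFractions.
Context {F : fieldType} {T : Type}.
Context (L : set T -> (T -> F) -> Prop).

Definition frac_open (U : set T) : Prop :=
  forall x, U x -> exists D h, [/\ L D h, D x, h x != 0 &
    D `&` [set y | h y != 0] `<=` U].

Definition frac_regular (U : set T) (f : T -> F) : Prop :=
  forall x, U x -> exists W, [/\ frac_open W, W x, W `<=` U &
    exists D g h, [/\ L D g, L D h, W `<=` D &
      forall y, W y -> h y != 0 /\ f y = g y / h y]].

Context (L_cst : forall c, L setT (fun=> c)).
Context (LD : forall D f g, L D f -> L D g -> L D (fun x => f x + g x)).
Context (LM : forall D f g, L D f -> L D g -> L D (fun x => f x * g x)).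
Context (L_sub : forall D D' f g, L D f -> L D' g -> L (D `&` D') f).

Let L_subr D D' f g : L D f -> L D' g -> L (D `&` D') g.
Proof. by move=> Lf Lg; rewrite setIC; exact: L_sub Lg Lf. Qed.

Lemma frac_openT : frac_open setT.
Proof.
by move=> x _; exists setT, (fun=> 1); split=> //; rewrite oner_eq0.
Qed.

Lemma frac_openI : setI_closed frac_open.
Proof.
move=> U V oU oV x [/oU [D [h [Lh Dx hx sU]]] /oV [D' [h' [Lh' Dx' hx' sV]]]].
exists (D `&` D'), (fun x => h x * h' x); split => //.
- exact: LM (L_sub Lh Lh') (L_subr Lh Lh').
- by rewrite mulf_neq0.
move=> y [[Dy Dy'] /=]; rewrite mulf_eq0 negb_or => /andP[hy hy'].
by split; [exact: sU|exact: sV].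
Qed.

Lemma frac_open_bigU (I : Type) (f : I -> set T) :
  (forall i, frac_open (f i)) -> frac_open (\bigcup_i f i).
Proof.
move=> o x [i _ /o [D [h [Lh Dx hx s]]]]; exists D, h; split=> //.
by move=> y /s fy; exists i.
Qed.

Definition frac_top : topologicalType :=
  HB.pack T (gen_eqMixin T) (gen_choiceMixin T)
    (isOpenTopological.Build (classic_choice T)
       frac_openT frac_openI frac_open_bigU).

Lemma frac_openE (U : set frac_top) : open U = frac_open U.
Proof. by []. Qed.

Let frac_openD D h : L D h -> frac_open (D `&` [set y | h y != 0]).
Proof. by move=> Lh x [Dx hx]; exists D, h; split. Qed.

Let frac_loc (P : F -> F -> F) : 
    (forall D g h g' h', L D g -> L D h -> L D g' -> L D h' ->
      exists k, L D k /\ forall y, h y != 0 -> h' y != 0 -> 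
        P (g y / h y) (g' y / h' y) = k y / (h y * h' y)) ->
  forall U f f', frac_open U -> frac_regular U f -> frac_regular U f' ->
    frac_regular U (fun x => P (f x) (f' x)).
Proof.
move=> HP U f f' oU rf rf' x Ux.
have [W [oW Wx WU [D [g [h [Lg Lh WD H]]]]]] := rf x Ux.
have [W' [oW' Wx' WU' [D' [g' [h' [Lg' Lh' WD' H']]]]]] := rf' x Ux.
have [k [Lk Hk]] := HP _ _ _ _ _ (L_sub Lg Lg') (L_sub Lh Lg')
  (L_subr Lg Lg') (L_subr Lg Lh').
exists (W `&` W'); split => //; first exact: frac_openI.
  by move=> y [/WU].
exists (D `&` D'), k, (fun y => h y * h' y); split => //.
- exact: LM (L_sub Lh Lh') (L_subr Lh Lh').
- by move=> y [/WD Dy /WD' Dy'].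
move=> y [/H [hy ->] /H' [hy' ->]]; split; first by rewrite mulf_neq0.
exact: Hk.
Qed.

Definition frac_fspace : fspace F.
Proof.
refine (@FSpace F frac_top frac_regular _ _ _ _ _ _ _).
- move=> U V f g oV sVU efg rf x Vx.
  have [W [oW Wx WU [D [a [b [La Lb WD H]]]]]] := rf x (sVU _ Vx).
  exists (W `&` V); split=> //; first exact: frac_openI.
  exists D, a, b; split=> //; first by move=> y [/WD].
  by move=> y [/H [by0 fy] Vy]; rewrite -efg.
- move=> U f oU H x Ux; have [V [oV Vx] rf] := H x Ux.
  have [W [oW Wx WV [D [a [b [La Lb WD E]]]]]] := rf x Vx.
  exists (W `&` U); split=> //; first exact: frac_openI.
  exists D, a, b; split=> //; first by move=> y [/WD].
  by move=> y [/E].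
- move=> U c oU x Ux; exists U; split=> //.
  exists setT, (fun=> c), (fun=> 1); split=> // y _.
  by rewrite oner_eq0 divr1.
- move=> U f g; apply: (frac_loc (P := fun a b => a + b)).
  move=> D a b a' b' La Lb La' Lb'.
  exists (fun y => a y * b' y + a' y * b y); split; first by apply: LD; apply: LM.
  by move=> y b0 b0'; rewrite addf_div.
- move=> U f g; apply: (frac_loc (P := fun a b => a * b)).
  move=> D a b a' b' La Lb La' Lb'.
  exists (fun y => a y * a' y); split; first exact: LM.
  by move=> y b0 b0'; rewrite mulf_div.
- move=> U f oU rf; rewrite frac_openE => x [Ux /= fx].
  have [W [oW Wx WU [D [a [b [La Lb WD H]]]]]] := rf x Ux.
  have [bx fxE] := H x Wx.
  have ax : a x != 0 by move: fx; rewrite fxE mulf_eq0 negb_or => /andP[].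
  have [|E [h [Lh Ex hx s]]] := frac_openI oW (frac_openD La) (x := x).
    by split=> //; split=> //; exact: WD.
  exists E, h; split=> // y /s [Wy [_ /= ay]]; split; first exact: WU.
  by have [by0 /= ->] := H y Wy; rewrite mulf_neq0 ?invr_eq0.
- move=> U f oU rf x [Ux /= fx].
  have [W [oW Wx WU [D [a [b [La Lb WD H]]]]]] := rf x Ux.
  have nz y : W y -> f y != 0 -> a y != 0.
    by move=> /H [_ ->]; rewrite mulf_eq0 negb_or => /andP[].
  exists (W `&` (D `&` [set y | a y != 0])); split.
  + exact/frac_openI/frac_openD.
  + by split=> //; split; [exact: WD|exact: nz].
  + move=> y [Wy [_ /= ay]]; split; first exact: WU.
    by have [by0 /= ->] := H y Wy; rewrite mulf_neq0 ?invr_eq0.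
  exists D, b, a; split=> //; first by move=> y [_ []].
  by move=> y [/H [_ ->] [_ /= ay]]; rewrite invf_div.
Defined.

End LocalFractions.

(* A finite-dimensional vector space V as an affine space; A^d is
   [affine 'rV[F]_d].  Polynomial functions do not depend on the basis. *)
Section Affine.
Context {F : fieldType} (V : vectType F).

Definition polynomial_function (f : V -> F) : Prop :=
  exists P : {mpoly F[\dim {:V}]},
    forall v, f v = P.@[fun i => coord (vbasis {:V}) i v].

Definition affine_local (D : set V) (f : V -> F) : Prop :=
  D = setT /\ polynomial_function f.

Fact affine_cst c : affine_local setT (fun=> c).
Proof. by split=> //; exists c%:MP => v; rewrite mevalC. Qed.

Fact affineD D f g : affine_local D f -> affine_local D g ->
  affine_local D (fun x => f x + g x).
Proof.
move=> [-> [P HP]] [_ [Q HQ]]; split=> //; exists (P + Q) => v.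
by rewrite mevalD HP HQ.
Qed.

Fact affineM D f g : affine_local D f -> affine_local D g ->
  affine_local D (fun x => f x * g x).
Proof.
move=> [-> [P HP]] [_ [Q HQ]]; split=> //; exists (P * Q) => v.
by rewrite mevalM HP HQ.
Qed.

Fact affine_sub D D' f g : affine_local D f -> affine_local D' g ->
  affine_local (D `&` D') f.
Proof. by move=> [-> ?] [-> _]; rewrite setIT. Qed.

Definition affine : fspace F :=
  frac_fspace affine_cst affineD affineM affine_sub.

End Affine.

(* The product: local functions are the finite sums of f(x) g(y) with f and g
   regular on open sets of the factors. *)
Section Product.
Context {F : fieldType} (X Y : fspace F).

Definition tensor_local (D : set (X * Y)) (h : X * Y -> F) : Prop :=
  exists (U : set X) (V : set Y) (I : finType) (f : I -> X -> F) (g : I -> Y -> F),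
    [/\ open U, open V, D = U `*` V,
        forall i, regular U (f i) /\ regular V (g i) &
        forall z, h z = \sum_i f i z.1 * g i z.2].

Fact tensor_cst c : tensor_local setT (fun=> c).
Proof.
exists setT, setT, unit, (fun _ _ => c), (fun _ _ => 1); split.
- exact: openT.
- exact: openT.
- by rewrite setXTT.
- by move=> _; split; apply: regular_cst; exact: openT.
- by move=> z; rewrite big_const cardT enumT unlock /= addr0 mulr1.
Qed.

Fact tensor_sub D D' f g : tensor_local D f -> tensor_local D' g ->
  tensor_local (D `&` D') f.
Proof.
move=> [U [V [I [a [b [oU oV -> r E]]]]]] [U' [V' [I' [a' [b' [oU' oV' -> _ _]]]]]].
exists (U `&` U'), (V `&` V'), I, a, b; split=> //.
- exact: openI.
- exact: openI.
- by rewrite setXI.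
move=> i; have [ra rb] := r i; split.
  by apply: regular_sub ra => //; exact: openI.
by apply: regular_sub rb => //; exact: openI.
Qed.

(* Two presentations over the same D may use different boxes only if D is
   empty, so they are first brought to the intersection of the boxes. *)
Let tensor2 D f g : tensor_local D f -> tensor_local D g ->
  exists (U : set X) (V : set Y) (I J : finType) (a : I -> X -> F) (b : I -> Y -> F)
         (c : J -> X -> F) (d : J -> Y -> F),
    [/\ open U /\ open V, D = U `*` V,
        forall i, regular U (a i) /\ regular V (b i),
        forall i, regular U (c i) /\ regular V (d i) &
        (forall z, f z = \sum_i a i z.1 * b i z.2) /\
        (forall z, g z = \sum_i c i z.1 * d i z.2)].
Proof.
move=> [U [V [I [a [b [oU oV DE r E]]]]]] [U' [V' [J [c [d [oU' oV' DE' r' E']]]]]].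
have oUU := openI oU oU'; have oVV := openI oV oV'.
exists (U `&` U'), (V `&` V'), I, J, a, b, c, d; split=> //.
- by rewrite setXI -DE -DE' setIid.
- move=> i; have [ra rb] := r i; split.
    by apply: regular_sub ra => //.
  by apply: regular_sub rb => //.
- move=> i; have [ra rb] := r' i; split.
    by apply: regular_sub ra => //.
  by apply: regular_sub rb => //.
Qed.

Fact tensorD D f g : tensor_local D f -> tensor_local D g ->
  tensor_local D (fun x => f x + g x).
Proof.
move=> tf /(tensor2 tf) [U [V [I [J [a [b [c [d [[oU oV] DE r r' [E E']]]]]]]]]].
exists U, V, (I + J)%type,
  (fun k => match k with inl i => a i | inr j => c j end),
  (fun k => match k with inl i => b i | inr j => d j end); split=> //.
  by case.
by move=> z; rewrite big_sumType /= E E'.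
Qed.

Fact tensorM D f g : tensor_local D f -> tensor_local D g ->
  tensor_local D (fun x => f x * g x).
Proof.
move=> tf /(tensor2 tf) [U [V [I [J [a [b [c [d [[oU oV] DE r r' [E E']]]]]]]]]].
exists U, V, (I * J)%type,
  (fun k x => a k.1 x * c k.2 x), (fun k y => b k.1 y * d k.2 y); split=> //.
  move=> [i j] /=; have [? ?] := r i; have [? ?] := r' j.
  by split; apply: regularM.
move=> z; rewrite E E' big_distrlr /= pair_big /=.
by apply: eq_bigr => k _; rewrite mulrACA.
Qed.

Definition fs_prod : fspace F :=
  frac_fspace tensor_cst tensorD tensorM tensor_sub.

End Product.

(* The induced structure on a subset: for A locally closed in a variety this is
   the reduced subvariety A. *)
Section Subspace.
Context {F : fieldType} (X : fspace F) (A : set X).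

Definition sub_top : topologicalType :=
  initial_topology (sval : classic_choice {x | A x} -> X).

Definition sub_regular (U : set {x | A x}) (f : {x | A x} -> F) : Prop :=
  forall x, U x -> exists (W : set X) (g : X -> F),
    [/\ open W, W (sval x), sval @^-1` W `<=` U, regular W g &
        forall y, W (sval y) -> f y = g (sval y)].

Let sub_openP (U : set sub_top) :
  open U <-> exists2 W : set X, open W & sval @^-1` W = U.
Proof. by []. Qed.

Definition fs_sub : fspace F.
Proof.
refine (@FSpace F sub_top sub_regular _ _ _ _ _ _ _).
- move=> U V f g /sub_openP [V' oV' <-] sVU efg rf x Vx.
  have [W [h [oW Wx WU rh E]]] := rf x (sVU _ Vx).
  exists (W `&` V'), h; split=> //.
  + exact: openI.
  + by move=> y [].
  + by apply: regular_sub rh => //; exact: openI.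
  + by move=> y [Wy Vy]; rewrite -efg // E.
- move=> U f /sub_openP [U' oU' <-] H x Ux; have [V [oV Vx] rf] := H x Ux.
  have [W [h [oW Wx WV rh E]]] := rf x Vx.
  exists (W `&` U'), h; split=> //.
  + exact: openI.
  + by move=> y [].
  + by apply: regular_sub rh => //; exact: openI.
  + by move=> y [Wy _]; exact: E.
- move=> U c /sub_openP [U' oU' <-] x Ux; exists U', (fun=> c); split=> //.
  exact: regular_cst.
- move=> U f g oU rf rg x Ux.
  have [W [h [oW Wx WU rh E]]] := rf x Ux.
  have [W' [h' [oW' Wx' WU' rh' E']]] := rg x Ux.
  have oWW := openI oW oW'.
  exists (W `&` W'), (fun x => h x + h' x); split=> //.
  + by move=> y [/WU].
  + apply: regularD => //; first by apply: regular_sub rh => //.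
    by apply: regular_sub rh' => //.
  + by move=> y [/E -> /E' ->].
- move=> U f g oU rf rg x Ux.
  have [W [h [oW Wx WU rh E]]] := rf x Ux.
  have [W' [h' [oW' Wx' WU' rh' E']]] := rg x Ux.
  have oWW := openI oW oW'.
  exists (W `&` W'), (fun x => h x * h' x); split=> //.
  + by move=> y [/WU].
  + apply: regularM => //; first by apply: regular_sub rh => //.
    by apply: regular_sub rh' => //.
  + by move=> y [/E -> /E' ->].
- move=> U f oU rf; rewrite openE => x [Ux /= fx].
  have [W [h [oW Wx WU rh E]]] := rf x Ux.
  rewrite /interior nbhsE /=.
  exists (sval @^-1` (W `&` [set z | h z != 0])).
    split; last by split=> //=; rewrite -E.
    by apply/sub_openP; eexists; first exact: (regular_nz oW rh).
  by move=> y [Wy /= hy]; split; [exact: WU|rewrite /= E].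
- move=> U f oU rf x [Ux /= fx].
  have [W [h [oW Wx WU rh E]]] := rf x Ux.
  exists (W `&` [set z | h z != 0]), (fun z => (h z)^-1); split.
  + exact: regular_nz.
  + by split=> //=; rewrite -E.
  + by move=> y [Wy /= hy]; split; [exact: WU|rewrite /= E].
  + exact: regularV.
  + by move=> y [/E -> _].
Defined.

End Subspace.

(* The quotient structure on Y along q (used for q surjective).  When the
   fibres of q are the orbits of a group acting on X, the regular functions on
   U are the invariant regular functions on the preimage of U. *)
Section Quotient.
Context {F : fieldType} (X : fspace F) (Y : Type) (q : X -> Y).

Definition quo_open (U : set Y) : Prop := open (q @^-1` U).

Fact quo_openT : quo_open setT.
Proof. exact: openT. Qed.

Fact quo_openI : setI_closed quo_open.
Proof. by move=> U V oU oV; exact: openI. Qed.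

Fact quo_open_bigU (I : Type) (f : I -> set Y) :
  (forall i, quo_open (f i)) -> quo_open (\bigcup_i f i).
Proof. by move=> o; apply: bigcup_open => i _; exact: o. Qed.

Definition quo_top : topologicalType :=
  HB.pack Y (gen_eqMixin Y) (gen_choiceMixin Y)
    (isOpenTopological.Build (classic_choice Y)
       quo_openT quo_openI quo_open_bigU).

Definition quo_regular (U : set Y) (f : Y -> F) : Prop :=
  regular (q @^-1` U) (f \o q).

Definition fs_quo : fspace F.
Proof.
refine (@FSpace F quo_top quo_regular _ _ _ _ _ _ _).
- move=> U V f g oV sVU efg rf; apply: regular_sub rf => //.
  + by move=> x; exact: sVU.
  + by move=> x /= Vx; exact: efg.
- move=> U f oU H; apply: regular_glue => // x Ux.
  by have [V [oV Vx] rf] := H _ Ux; exists (q @^-1` V).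
- by move=> U c oU; exact: regular_cst.
- by move=> U f g oU rf rg; exact: (regularD oU rf rg).
- by move=> U f g oU rf rg; exact: (regularM oU rf rg).
- by move=> U f oU rf; exact: (regular_nz oU rf).
- by move=> U f oU rf; exact: (regularV oU rf).
Defined.

End Quotient.

Section CellDecompositions.
Context {F : fieldType}.

Definition locally_closed (X : fspace F) (A : set X) : Prop :=
  exists U C : set X, [/\ open U, closed C & A = U `&` C].

(* [partition] includes that the cells are nonempty, so the index type K is in
   bijection with the set of cells. *)
Definition cell_decomposition (X : fspace F) (K : finType)
    (cell : K -> set X) (d : K -> nat) : Prop :=
  [/\ partition [set: K] cell [set: X],
      forall k, locally_closed (cell k) &
      forall k, fs_isomorphic (fs_sub (cell k)) (affine 'rV[F]_(d k))].

Definition identical_cells (K K' : finType) (d : K -> nat) (d' : K' -> nat) :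
    Prop :=
  exists2 phi : K -> K', bijective phi & forall k, d' (phi k) = d k.

End CellDecompositions.

(* A (geometric) vector bundle of rank r: e |-> (proj e, coord i e) identifies
   the restriction of the total space to [dom i] with dom i x A^r, and any two
   of these trivializations differ by a linear automorphism of each fibre. *)
Record vbundle (F : fieldType) (B : fspace F) (r : nat) := VBundle {
  vb_total :> fspace F;
  vb_proj : vb_total -> B;
  vb_proj_morphism : fs_morphism vb_proj;
  vb_index : Type;
  vb_dom : vb_index -> set B;
  vb_coord : vb_index -> vb_total -> 'rV[F]_r;
  vb_dom_open : forall i, open (vb_dom i);
  vb_dom_cover : \bigcup_i vb_dom i = [set: B];
  vb_trivial : forall i,
    @fs_isomorphism F (fs_sub (vb_proj @^-1` vb_dom i))
      (fs_prod (fs_sub (vb_dom i)) (affine 'rV[F]_r))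
      (fun e => (exist (vb_dom i) (vb_proj (sval e)) (svalP e),
                 vb_coord i (sval e)));
  vb_transition : forall i j b, vb_dom i b -> vb_dom j b ->
    exists2 g : 'M[F]_r, g \in unitmx &
      forall e, vb_proj e = b -> vb_coord j e = vb_coord i e *m g
}.

Section Grassmannian.
Context (F : fieldType) (n N : nat).

Definition row_tuple (M : 'M[F]_(n, N)) : n.-tuple 'rV[F]_N :=
  [tuple row i M | i < n].

Definition gras_points := {W : {vspace 'rV[F]_N} | \dim W == n}.

Definition frames : fspace F :=
  @fs_sub F (affine 'M[F]_(n, N)) [set M | free (row_tuple M)].

Fact dim_row_span (M : frames) : \dim <<row_tuple (sval M)>>%VS == n.
Proof. by have /eqP -> := svalP M; rewrite size_tuple. Qed.

(* Gras_n(N) as the variety of frames modulo change of basis. *)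
Definition Gras : fspace F :=
  @fs_quo F frames gras_points
    (fun M => exist _ <<row_tuple (sval M)>>%VS (dim_row_span M)).

Definition flag (k : nat) : {vspace 'rV[F]_N} :=
  <<[seq delta_mx 0%R j | j : 'I_N <- enum 'I_N & (j < k)%N]>>%VS.

Definition nsubset := {I : {set 'I_N} | #|I| == n}.

Definition schubert_cell (I : nsubset) : set Gras :=
  [set W | forall k,
     \dim (sval W :&: flag k)%VS = #|[pred i in sval I | (i < k)%N]|].

(* For I = {i_1 < ... < i_n}, this is the sum of the i_j - j (counted from 1). *)
Definition schubert_dim (I : nsubset) : nat :=
  (\sum_(i in sval I) #|[pred j : 'I_N | (j < i)%N && (j \notin sval I)]|)%N.

(* The natural cell decomposition of a vector bundle E over Gras_n(N). *)
Definition natural_cell (r : nat) (E : vbundle Gras r) (I : nsubset) : set E :=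
  @vb_proj F Gras r E @^-1` schubert_cell I.

Definition natural_dim (r : nat) (I : nsubset) : nat := (schubert_dim I + r)%N.

End Grassmannian.

Section Systems.
Context (F : fieldType) (m n p : nat).

Definition system := ('M[F]_n * 'M[F]_(n, m) * 'M[F]_(p, n))%type.

Definition gl_act (g : 'M[F]_n) (S : system) : system :=
  let: (A, B, C) := S in (g *m A *m invmx g, g *m B, C *m invmx g).

Definition gl_orbit (S : system) : set system :=
  [set gl_act g S | g in [set g | g \in unitmx]].

Definition ctrl_mx (S : system) : 'M[F]_(n, \sum_(j < n) m) :=
  let: (A, B, C) := S in \mxrow_(j < n) (A ^+ j *m B).

Definition completely_controllable (S : system) : Prop := \rank (ctrl_mx S) = n.

Definition Vcc : fspace F := @fs_sub F (affine system) completely_controllable.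

Definition cc_orbits :=
  {O : set system | exists2 S, completely_controllable S & O = gl_orbit S}.

(* The moduli space sys^cc as the orbit space V^cc / GL_n. *)
Definition syscc : fspace F :=
  @fs_quo F Vcc cc_orbits
    (fun S => exist _ (gl_orbit (sval S)) (ex_intro2 _ _ _ (svalP S) erefl)).

End Systems.

(* Main.v *)
From HB Require Import structures.
Require Import Defs.
Set Implicit Arguments.
Unset Strict Implicit.
Unset Printing Implicit Defensive.

Import GRing.Theory.
Local Open Scope classical_set_scope.
Local Open Scope ring_scope.

(** Both varieties are quotients of a subset of an affine space by GL_n, and on
both sides a cell is the set of orbits that meet an explicit affine subspace of
normal forms.

For an n-subset I of [0, N), N = m + n - 1, the frames M whose I-columns form an
invertible minor have the normal form M_I^-1 M, which depends only on the span.
The span lies in the Schubert cell of I exactly when M_I is invertible and the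
normal form is an echelon matrix: the identity in the columns I and, in row j,
zero to the right of the j-th pivot ([schubert_cell_echelon]).  The entries that
remain free number dim S_I.  For the vector bundle the trivial one suffices, so
its natural cells are S_I x A^((p+1)n).

For a system (A, B, C), read vectors one at a time, starting from the first
column of B.  If the vector read is independent of those kept before it, keep it,
and the next vector read is its image under A; otherwise discard it, and the next
one is the next column of B.  This is the selection that underlies the Hermite
form of the controllability matrix.  The vectors kept span the reachable space,
so for a controllable system exactly n vectors are kept among the first N, and
m - 1 are discarded ([greedy_count]).  Recording the N decisions from right to
left gives an n-subset I of [0, N), constant on orbits; this partitions the
moduli space into cells indexed by the same set as the Schubert cells.

On the cell of I the kept vectors form a basis, and writing the system in that
basis is a normal form depending only on the orbit.  Every vector read is then a
column of A (after a kept vector) or of B (after a discarded one), and each of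
the m + n columns is read exactly once: the columns of A and B, sorted into
reading order, form an n x (N + 1) matrix.  Its last N columns are an arbitrary
echelon matrix for I, its first column (the vector read after the N-th decision)
is an arbitrary vector, and C is arbitrary
([greedy_canonical], [canonical_paramP]).  Hence the cell is an affine space of
dimension dim S_I + n + pn, the dimension of the natural cell of I.

That these bijections are isomorphisms of varieties, and that the cells are
locally closed, is one argument for both sides, [slice_isomorphic] and
[slice_locally_closed]: the normal form is an invariant map with regular
entries, so it descends to the quotient. *)

(** * Regular maps into affine spaces *)

Section RegularFunctions.
Context {F : fieldType} (X : fspace F).
Implicit Types (U : set X) (f g : X -> F).

Lemma open_pointwise (T : topologicalType) (A : set T) :
  (forall x, A x -> exists2 B, open B /\ B x & B `<=` A) -> open A.
Proof.
move=> H; rewrite openE => x /H [B [oB Bx] BA].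
by rewrite /interior nbhsE; exists B.
Qed.

Lemma regular_restr U U' f : open U' -> U' `<=` U -> regular U f -> regular U' f.
Proof. by move=> oU' s; apply: regular_sub. Qed.

Lemma regular_ext U f g : open U -> (forall x, U x -> f x = g x) ->
  regular U f -> regular U g.
Proof. by move=> oU e; apply: regular_sub. Qed.

Lemma regular_sum U (I : Type) (r : seq I) (P : pred I) (f : I -> X -> F) :
  open U -> (forall i, regular U (f i)) ->
  regular U (fun x => \sum_(i <- r | P i) f i x).
Proof.
move=> oU H; elim: r => [|i r IH].
  by apply: (regular_ext (f := fun=> 0)) (regular_cst 0 oU) => // x _; rewrite big_nil.
apply: (regular_ext (f := fun x => (if P i then f i x else 0) +
    \sum_(i <- r | P i) f i x)) => //.
  by move=> x _; rewrite big_cons; case: ifP => //; rewrite add0r.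
apply: regularD => //; case: (P i) => //; exact: regular_cst.
Qed.

Lemma regular_prod U (I : Type) (r : seq I) (P : pred I) (f : I -> X -> F) :
  open U -> (forall i, regular U (f i)) ->
  regular U (fun x => \prod_(i <- r | P i) f i x).
Proof.
move=> oU H; elim: r => [|i r IH].
  by apply: (regular_ext (f := fun=> 1)) (regular_cst 1 oU) => // x _; rewrite big_nil.
apply: (regular_ext (f := fun x => (if P i then f i x else 1) *
    \prod_(i <- r | P i) f i x)) => //.
  by move=> x _; rewrite big_cons; case: ifP => //; rewrite mul1r.
apply: regularM => //; case: (P i) => //; exact: regular_cst.
Qed.

Lemma regular_exp U f k : open U -> regular U f -> regular U (fun x => f x ^+ k).
Proof.
move=> oU rf; apply: (regular_ext (f := fun x => \prod_(i < k) f x)) => //.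
  by move=> x _; rewrite prodr_const card_ord.
exact: regular_prod.
Qed.

Lemma regular_inv U f : open U -> (forall x, U x -> f x != 0) ->
  regular U f -> regular U (fun x => (f x)^-1).
Proof.
move=> oU nz rf; have := regularV oU rf.
by have -> : U `&` [set x | f x != 0] = U by apply/setIidl => x /nz.
Qed.

(** The coordinate-wise form of a morphism from U to an affine space.  It also
makes sense on an open subset without forming the induced structure on it. *)
Definition regular_map U (V : vectType F) (phi : X -> V) : Prop :=
  forall i, regular U (fun x => coord (vbasis {:V}) i (phi x)).

Lemma regular_map_restr U U' (V : vectType F) (phi : X -> V) :
  open U' -> U' `<=` U -> regular_map U phi -> regular_map U' phi.
Proof. by move=> oU' s r i; apply: regular_restr (r i). Qed.

Lemma regular_map_ext U (V : vectType F) (phi psi : X -> V) : open U ->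
  (forall x, U x -> phi x = psi x) -> regular_map U phi -> regular_map U psi.
Proof.
by move=> oU e r i; apply: regular_ext (r i) => // x Ux; rewrite e.
Qed.

Lemma regular_map_cst U (V : vectType F) (v : V) : open U ->
  regular_map U (fun=> v).
Proof. by move=> oU i; exact: regular_cst. Qed.

Lemma regular_mapD U (V : vectType F) (phi psi : X -> V) : open U ->
  regular_map U phi -> regular_map U psi -> regular_map U (fun x => phi x + psi x).
Proof.
move=> oU rp rq i; apply: (regular_ext (f := fun x =>
  coord (vbasis {:V}) i (phi x) + coord (vbasis {:V}) i (psi x))) => //.
  by move=> x _; rewrite linearD.
exact: regularD.
Qed.

(** The criterion behind the other closure properties: a combination of fixed
vectors with regular coefficients is regular whatever the chosen basis. *)
Lemma regular_map_sum U (V : vectType F) (I : Type) (r : seq I) (P : pred I)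
    (c : I -> X -> F) (v : I -> V) : open U -> (forall i, regular U (c i)) ->
  regular_map U (fun x => \sum_(i <- r | P i) c i x *: v i).
Proof.
move=> oU rc k; apply: (regular_ext (f := fun x => \sum_(i <- r | P i)
    c i x * coord (vbasis {:V}) k (v i))) => //.
  by move=> x _; rewrite linear_sum; apply: eq_bigr => i _; rewrite linearZ.
apply: regular_sum => // i; apply: regularM => //; exact: regular_cst.
Qed.

Lemma regular_map_linear U (V W : vectType F) (f : {linear V -> W}) (phi : X -> V) :
  open U -> regular_map U phi -> regular_map U (fun x => f (phi x)).
Proof.
move=> oU rp; apply: (regular_map_ext (phi := fun x => \sum_i
   coord (vbasis {:V}) i (phi x) *: f (vbasis {:V})`_i)) => //.
  move=> x _; rewrite [in RHS](coord_vbasis (memvf (phi x))) linear_sum.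
  by apply: eq_bigr => i _; rewrite linearZ.
exact: regular_map_sum.
Qed.

Lemma regular_functional U (V : vectType F) (f : V -> F) (phi : X -> V) :
  scalar f -> open U -> regular_map U phi -> regular U (fun x => f (phi x)).
Proof.
move=> lf oU rp.
pose fL : {linear V -> F^o} := HB.pack f (GRing.isLinear.Build _ _ _ _ f lf).
apply: (regular_ext (f := fun x => \sum_i
   coord (vbasis {:V}) i (phi x) * fL (vbasis {:V})`_i)) => //.
  move=> x _; rewrite -[f _]/(fL _) [in RHS](coord_vbasis (memvf (phi x))) linear_sum.
  by apply: eq_bigr => i _; rewrite linearZ.
apply: regular_sum => // i; apply: regularM => //; exact: regular_cst.
Qed.

Lemma regular_mapB U (V : vectType F) (phi psi : X -> V) : open U ->
  regular_map U phi -> regular_map U psi -> regular_map U (fun x => phi x - psi x).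
Proof.
move=> oU rp rq; apply: regular_mapD => //.
exact: (@regular_map_linear _ _ _ (@GRing.opp V)).
Qed.

Lemma regular_map_pair U (V W : vectType F) (phi : X -> V) (psi : X -> W) :
  open U -> regular_map U phi -> regular_map U psi ->
  regular_map U (fun x => (phi x, psi x)).
Proof.
move=> oU rp rq; apply: (regular_map_ext (phi := fun x =>
  \sum_i coord (vbasis {:V}) i (phi x) *: ((vbasis {:V})`_i, 0) +
  \sum_i coord (vbasis {:W}) i (psi x) *: (0, (vbasis {:W})`_i))) => //.
  move=> x _.
  rewrite [in RHS](coord_vbasis (memvf (phi x))) [in RHS](coord_vbasis (memvf (psi x))).
  rewrite [LHS]surjective_pairing /=.
  rewrite !(raddf_sum fst) !(raddf_sum snd) /=.
  congr pair; first by rewrite [X in _ + X]big1 ?addr0 // => i _; rewrite scaler0.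
  by rewrite [X in X + _]big1 ?add0r // => i _; rewrite scaler0.
by apply: regular_mapD => //; apply: regular_map_sum.
Qed.

Lemma regular_map_fst U (V W : vectType F) (phi : X -> V * W) :
  open U -> regular_map U phi -> regular_map U (fun x => (phi x).1).
Proof. exact: (@regular_map_linear _ _ _ fst). Qed.

Lemma regular_map_snd U (V W : vectType F) (phi : X -> V * W) :
  open U -> regular_map U phi -> regular_map U (fun x => (phi x).2).
Proof. exact: (@regular_map_linear _ _ _ snd). Qed.

Lemma regular_map_mx U a b (phi : X -> 'M[F]_(a, b)) : open U ->
  (regular_map U phi <-> forall i j, regular U (fun x => phi x i j)).
Proof.
move=> oU; split=> [rp i j|rp].
  apply: (@regular_functional _ _ (fun M : 'M[F]_(a, b) => M i j)) => //.
  by move=> c M M'; rewrite !mxE.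
apply: (regular_map_ext (phi := fun x => \sum_(t : 'I_a * 'I_b)
    phi x t.1 t.2 *: delta_mx t.1 t.2)) => //.
  move=> x _; rewrite [RHS]matrix_sum_delta pair_big //=.
exact: regular_map_sum.
Qed.

Lemma regular_map_mulmx U a b c (phi : X -> 'M[F]_(a, b)) (psi : X -> 'M[F]_(b, c)) :
  open U -> regular_map U phi -> regular_map U psi ->
  regular_map U (fun x => phi x *m psi x).
Proof.
move=> oU /(regular_map_mx _ oU) rp /(regular_map_mx _ oU) rq.
apply/regular_map_mx => // i j.
apply: (regular_ext (f := fun x => \sum_k phi x i k * psi x k j)) => //.
  by move=> x _; rewrite mxE.
by apply: regular_sum => // k; apply: regularM.
Qed.

Lemma regular_det U a (phi : X -> 'M[F]_a) : open U -> regular_map U phi ->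
  regular U (fun x => \det (phi x)).
Proof.
move=> oU /(regular_map_mx _ oU) rp; apply: regular_sum => // s.
apply: regularM => //; first exact: regular_cst.
exact: regular_prod.
Qed.

(** By Cramer's rule the entries of the inverse are cofactors over the
determinant. *)
Lemma regular_map_invmx U a (phi : X -> 'M[F]_a) : open U ->
  (forall x, U x -> phi x \in unitmx) -> regular_map U phi ->
  regular_map U (fun x => invmx (phi x)).
Proof.
move=> oU un rp; have rp' := (regular_map_mx _ oU).1 rp.
apply/regular_map_mx => // i j.
apply: (regular_ext (f := fun x => (\det (phi x))^-1 *
   ((-1) ^+ (j + i) * \det (row' j (col' i (phi x)))))) => //.
  by move=> x Ux; rewrite /invmx un // !mxE.
apply: regularM => //.
  apply: regular_inv => //; last exact: regular_det.
  by move=> x /un; rewrite unitmxE unitfE.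
apply: regularM => //; first exact: regular_cst.
apply: regular_det => //; apply/regular_map_mx => // k l.
by apply: regular_ext (rp' (lift j k) (lift i l)) => // x _; rewrite !mxE.
Qed.

Lemma regular_polynomial U (V : vectType F) (phi : X -> V) h : open U ->
  regular_map U phi -> polynomial_function h -> regular U (fun x => h (phi x)).
Proof.
move=> oU rp [P HP]; apply: (regular_ext (f := fun x => \sum_(k <- msupp P)
   P@_k * \prod_i coord (vbasis {:V}) i (phi x) ^+ k i)) => //.
apply: regular_sum => // k; apply: regularM => //; first exact: regular_cst.
by apply: regular_prod => // i; exact: regular_exp.
Qed.

Lemma regular_map_preimage U (V : vectType F) (phi : X -> V) (W : set (affine V)) :
  open U -> regular_map U phi -> open W -> open (U `&` phi @^-1` W).
Proof.
move=> oU rp; rewrite frac_openE => oW.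
apply: open_pointwise => x [Ux /oW [D [h [[-> ph] _ hx s]]]].
exists (U `&` [set y | h (phi y) != 0]).
  by split=> //; apply: regular_nz => //; exact: regular_polynomial.
by move=> y [Uy hy]; split=> //; apply: s.
Qed.

(** Locally a regular function on an affine space is a fraction of polynomials,
and polynomials in regular functions are regular. *)
Lemma regular_map_comp U (V : vectType F) (phi : X -> V) (W : set (affine V)) (h : V -> F) :
  open U -> regular_map U phi -> open W -> regular W h ->
  regular (U `&` phi @^-1` W) (h \o phi).
Proof.
move=> oU rp oW rg; apply: regular_glue; first exact: regular_map_preimage.
move=> x [Ux /rg [W' [oW' W'x W'W [D [a [b [[_ pa] [_ pb] _ E]]]]]]].
have oU' := regular_map_preimage oU rp oW'; have rp' := regular_map_restr oU' (@subIsetl _ _ _) rp.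
exists (U `&` phi @^-1` W') => //.
apply: (regular_ext (f := fun x => a (phi x) * (b (phi x))^-1)) => //.
  by move=> y [_ /E [_ /= ->]].
apply: regularM => //; first exact: regular_polynomial.
apply: regular_inv => //; last exact: regular_polynomial.
by move=> y [_ /E []].
Qed.

Lemma morphism_affine (V : vectType F) (phi : X -> V) :
  regular_map setT phi -> @fs_morphism F X (affine V) phi.
Proof.
move=> rp; split=> [W oW|W g oW rg].
  by have := regular_map_preimage openT rp oW; rewrite setTI.
by have := regular_map_comp openT rp oW rg; rewrite setTI.
Qed.

End RegularFunctions.

(** * Morphisms, products, subvarieties *)
Section Category.
Import VectorInternalTheory.
Context {F : fieldType}.
Implicit Types X Y Z : fspace F.

Lemma morphism_comp X Y Z (f : X -> Y) (g : Y -> Z) :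
  fs_morphism f -> fs_morphism g -> @fs_morphism F X Z (fun x => g (f x)).
Proof.
move=> [cf rf] [cg rg]; split=> [W oW|W h oW rh]; first by apply: (cf (g @^-1` W)); exact: cg.
by apply: (rf (g @^-1` W) (h \o g)); [exact: cg|exact: rg].
Qed.

Lemma fs_isomorphic_trans X Y Z :
  fs_isomorphic X Y -> fs_isomorphic Y Z -> fs_isomorphic X Z.
Proof.
move=> [f [mf [f' [mf' fK f'K]]]] [g [mg [g' [mg' gK g'K]]]].
exists (fun x => g (f x)); split; first exact: morphism_comp.
exists (fun z => f' (g' z)); split; first exact: morphism_comp.
- by move=> x; rewrite gK fK.
- by move=> z; rewrite f'K g'K.
Qed.

Lemma regular_map_id (V : vectType F) : @regular_map F (affine V) setT V id.
Proof.
move=> i; change (frac_regular (@affine_local F V) setT (coord (vbasis {:V}) i)).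
move=> x _; exists setT; split=> //; first exact: frac_openT (@affine_cst F V).
exists setT, (coord (vbasis {:V}) i), (fun=> 1); split=> //.
- by split=> //; exists 'X_i => v; rewrite mevalXU.
- exact: affine_cst.
- by move=> y _; rewrite oner_eq0 divr1.
Qed.

Lemma morphism_regular_map X (V : vectType F) (phi : X -> V) :
  @fs_morphism F X (affine V) phi -> regular_map setT phi.
Proof.
move=> [_ rp] i.
exact: (rp setT (coord (vbasis {:V}) i) openT (@regular_map_id V i)).
Qed.

Lemma morphism_linear (V W : vectType F) (f : {linear V -> W}) :
  @fs_morphism F (affine V) (affine W) f.
Proof.
apply/morphism_affine/(@regular_map_linear _ (affine V) _ _ _ f id); first exact: openT.
exact: regular_map_id.
Qed.

(** An affine space depends only on its dimension.  Parameter spaces can thus be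
products of spaces of matrices instead of spaces of row vectors. *)
Lemma affine_isomorphic (V W : vectType F) : \dim {:V} = \dim {:W} ->
  fs_isomorphic (affine V) (affine W).
Proof.
rewrite !dimvf => e.
pose f (v : V) : W := r2v (castmx (erefl, e) (v2r v)).
pose g (w : W) : V := r2v (castmx (erefl, esym e) (v2r w)).
have lf : linear f.
  move=> a u v; apply: v2r_inj.
  rewrite [RHS]linearP /f !r2vK linearP.
  by apply/rowP=> j; rewrite !(mxE, castmxE) /= !r2vK !castmxE.
have lg : linear g.
  move=> a u v; apply: v2r_inj.
  rewrite [RHS]linearP /g !r2vK linearP.
  by apply/rowP=> j; rewrite !(mxE, castmxE) /= !r2vK !castmxE.
pose fL : {linear V -> W} := HB.pack f (GRing.isLinear.Build _ _ _ _ f lf).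
pose gL : {linear W -> V} := HB.pack g (GRing.isLinear.Build _ _ _ _ g lg).
exists f; split; first exact: (morphism_linear fL).
exists g; split; first exact: (morphism_linear gL).
  by move=> v; rewrite /f /g r2vK castmx_comp castmx_id v2rK.
by move=> v; rewrite /f /g r2vK castmx_comp castmx_id v2rK.
Qed.

Lemma morphism_sval X (A : set X) : @fs_morphism F (fs_sub A) X sval.
Proof.
split=> [W oW|W g oW rg]; first by exists W.
by move=> x Wx; exists W, g; split.
Qed.

(** The universal property of the induced structure. *)
Lemma morphism_into_sub X Y (A : set Y) (f : X -> fs_sub A) :
  @fs_morphism F X Y (fun x => sval (f x)) -> fs_morphism f.
Proof.
move=> [cf rf]; have cf' V : open V -> open (f @^-1` V).
  by move=> [W oW <-]; exact: (cf W).
split=> // V g oV rg; apply: regular_glue; first exact: cf'.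
move=> x /rg [W [h [oW Wx WV rh E]]].
exists ((fun x => sval (f x)) @^-1` W); first by split=> //; exact: cf.
by apply: (regular_ext (f := h \o (fun x => sval (f x)))) (rf W h oW rh);
  [exact: cf|move=> y /E /= ->].
Qed.

Lemma morphism_fst X Y : @fs_morphism F (fs_prod X Y) X fst.
Proof.
have loc V g : open V -> regular V g -> @tensor_local F X Y (V `*` setT) (g \o fst).
  move=> oV rg; exists V, setT, unit, (fun=> g), (fun _ _ => 1); split=> //.
  - exact: openT.
  - by move=> _; split=> //; apply: regular_cst; exact: openT.
  - by move=> z; rewrite big_const cardT enumT unlock /= addr0 mulr1.
have op V : open V -> open (@fst X Y @^-1` V : set (fs_prod X Y)).
  move=> oV; change (frac_open (@tensor_local F X Y) (@fst X Y @^-1` V)).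
  move=> x Vx; exists (V `*` setT), (fun=> 1); split=> //.
  - exact: (loc V (fun=> 1) oV (regular_cst 1 oV)).
  - by rewrite oner_eq0.
  - by move=> y [[]].
split=> // V g oV rg.
change (frac_regular (@tensor_local F X Y) (@fst X Y @^-1` V) (g \o fst)).
move=> x Vx; exists (@fst X Y @^-1` V); split=> //; first exact: op.
exists (V `*` setT), (g \o fst), (fun=> 1); split=> //.
- exact: loc.
- exact: (loc V (fun=> 1) oV (regular_cst 1 oV)).
- by move=> y _; rewrite oner_eq0 divr1.
Qed.

Lemma morphism_snd X Y : @fs_morphism F (fs_prod X Y) Y snd.
Proof.
have loc V g : open V -> regular V g -> @tensor_local F X Y (setT `*` V) (g \o snd).
  move=> oV rg; exists setT, V, unit, (fun _ _ => 1), (fun=> g); split=> //.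
  - exact: openT.
  - by move=> _; split=> //; apply: regular_cst; exact: openT.
  - by move=> z; rewrite big_const cardT enumT unlock /= addr0 mul1r.
have op V : open V -> open (@snd X Y @^-1` V : set (fs_prod X Y)).
  move=> oV; change (frac_open (@tensor_local F X Y) (@snd X Y @^-1` V)).
  move=> x Vx; exists (setT `*` V), (fun=> 1); split=> //.
  - exact: (loc V (fun=> 1) oV (regular_cst 1 oV)).
  - by rewrite oner_eq0.
  - by move=> y [[]].
split=> // V g oV rg.
change (frac_regular (@tensor_local F X Y) (@snd X Y @^-1` V) (g \o snd)).
move=> x Vx; exists (@snd X Y @^-1` V); split=> //; first exact: op.
exists (setT `*` V), (g \o snd), (fun=> 1); split=> //.
- exact: loc.
- exact: (loc V (fun=> 1) oV (regular_cst 1 oV)).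
- by move=> y _; rewrite oner_eq0 divr1.
Qed.

(** The universal property of the product: on a basic open set a local function is
a sum of products f(x) g(y), hence it pulls back to a regular function. *)
Lemma morphism_pair X Y Z (f : Z -> X) (g : Z -> Y) :
  fs_morphism f -> fs_morphism g -> @fs_morphism F Z (fs_prod X Y) (fun z => (f z, g z)).
Proof.
move=> [cf rf] [cg rg].
pose fg z := (f z, g z).
have loc D h : @tensor_local F X Y D h ->
    open (fg @^-1` D) /\ regular (fg @^-1` D) (h \o fg).
  move=> [U [V [I [a [b [oU oV -> r E]]]]]].
  have oUV : open (fg @^-1` (U `*` V)) by apply: openI; [exact: cf|exact: cg].
  split=> //; apply: (regular_ext (f := fun z => \sum_i a i (f z) * b i (g z))) => //.
    by move=> z _ /=; rewrite E.
  apply: regular_sum => // i; have [ra rb] := r i; apply: regularM => //.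
    by apply: regular_restr (rf U (a i) oU ra) => // z [].
  by apply: regular_restr (rg V (b i) oV rb) => // z [].
have op (W : set (fs_prod X Y)) : open W -> open (fg @^-1` W).
  rewrite frac_openE => oW; apply: open_pointwise => z /oW [D [h [/loc [oD rh] Dz hz s]]].
  exists (fg @^-1` D `&` [set y | h (fg y) != 0]); last by move=> y [Dy hy]; exact: s.
  by split=> //; apply: regular_nz rh.
split=> // W h oW rh; apply: regular_glue; first exact: op.
move=> z /rh [W' [oW' W'z W'W [D [a [b [/loc [oD ra] /loc [_ rb] W'D E]]]]]].
have oW'' := op _ oW'; exists (fg @^-1` W') => //.
have s : fg @^-1` W' `<=` fg @^-1` D by move=> y /W'D.
apply: (regular_ext (f := fun y => a (fg y) * (b (fg y))^-1)) => //.
  by move=> y /E [_ /= ->].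
apply: regularM => //; first exact: regular_restr ra.
by apply: regular_inv => // [y /E []//|]; exact: regular_restr rb.
Qed.

Lemma locally_closed_preimage X Y (f : X -> Y) (A : set Y) : fs_morphism f ->
  locally_closed A -> locally_closed (f @^-1` A).
Proof.
move=> [cf _] [U [C [oU cC ->]]]; exists (f @^-1` U), (f @^-1` C); split=> //.
  exact: cf.
by rewrite -openC preimage_setC; apply: cf; rewrite openC.
Qed.

Lemma locally_closed_zeros X (U A : set X) (V : vectType F) (theta : X -> V) :
  open U -> regular_map U theta -> (forall x, A x <-> U x /\ theta x = 0) ->
  locally_closed A.
Proof.
move=> oU rt AE.
pose D := \bigcup_i (U `&` [set x | coord (vbasis {:V}) i (theta x) != 0]).
exists U, (~` D); split=> //.
  by apply: open_closedC; apply: bigcup_open => i _; exact: regular_nz.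
apply/seteqP; split=> x.
  move=> /AE [Ux tx]; split=> // -[i _ [_ /=]].
  by rewrite tx linear0 eqxx.
move=> [Ux nD]; apply/AE; split=> //.
rewrite (coord_vbasis (memvf (theta x))) big1 // => i _.
have [->|nz] := eqVneq (coord (vbasis {:V}) i (theta x)) 0; first by rewrite scale0r.
by case: nD; exists i.
Qed.

Lemma one_point_affine X (d : nat) : (exists x : X, forall y, y = x) -> d = 0%N ->
  fs_isomorphic X (affine 'rV[F]_d).
Proof.
move=> [x0 H] ->; exists (fun=> 0); split.
  by apply: morphism_affine; apply: regular_map_cst; exact: openT.
exists (fun=> x0); split; last 2 first.
- by move=> y; rewrite -(H y).
- by move=> v; apply/rowP => -[].
have op (W : set X) : open ((fun=> x0) @^-1` W : set (affine 'rV[F]_0)).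
  by rewrite preimage_cst; case: ifP => _; [exact: openT|exact: open0].
split=> // W g oW _; exact: regular_cst.
Qed.

End Category.

(** * Normal forms in a quotient *)

(** Y is the quotient of P, a subset of the affine space V, along q.  On the
saturated open set U the map phi sends each point to a normal form in the same
fibre of q (phi_fib), the same one for the whole fibre (phi_inv).  The affine space W
parametrizes by lam some of the normal forms, and kap recovers the parameters.
A is the set of classes whose normal form is parametrized by W. *)
Section Slice.
Context {F : fieldType} (V W : vectType F) (P : set (affine V)) (T : Type).
Context (q : fs_sub P -> T) (q_surj : forall y, exists x, q x = y).
Context (U : set (affine V)) (phi : V -> V) (lam : W -> V) (kap : {linear V -> W}).
Context (U_open : open U) (phi_reg : @regular_map F (affine V) U V phi).
Context (phi_inv : forall x x', q x = q x' -> U (sval x) ->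
  U (sval x') /\ phi (sval x) = phi (sval x')).
Context (phi_fib : forall x x', U (sval x) -> sval x' = phi (sval x) -> q x' = q x).
Context (lam_reg : @regular_map F (affine W) setT V lam).
Context (lam_P : forall t, P (lam t)).
Context (lam_U : forall t, U (lam t)).
Context (phi_lam : forall t, phi (lam t) = lam t).
Context (lamK : forall t, kap (lam t) = t).
Context (A : set (fs_quo q)).
Context (AE : forall x, A (q x) <->
  U (sval x) /\ lam (kap (phi (sval x))) = phi (sval x)).

(* An arbitrary choice of representatives: by invariance, phi of the
   representative is nevertheless regular. *)
Let rep (y : fs_quo q) : fs_sub P := sval (cid (q_surj y)).
Let repK y : q (rep y) = y. Proof. exact: svalP (cid (q_surj y)). Qed.
Let UY : set (fs_quo q) := [set y | U (sval (rep y))].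
Let UYE x : UY (q x) <-> U (sval x).
Proof. by split=> [/(phi_inv (repK _)) []|/(phi_inv (esym (repK (q x)))) []]. Qed.
Let UY_preim : q @^-1` UY = sval @^-1` U.
Proof. by apply/seteqP; split=> x /UYE. Qed.
Let UY_open : open UY.
Proof.
rewrite /open /= /quo_open UY_preim; exact: (morphism_sval P).1.
Qed.

Let chi (y : fs_quo q) : V := phi (sval (rep y)).
Let chiE x : U (sval x) -> chi (q x) = phi (sval x).
Proof. by move=> /(phi_inv (esym (repK (q x)))) []. Qed.

Let chi_reg : regular_map UY chi.
Proof.
move=> i; have oU' : open (q @^-1` UY) := UY_open.
have s : q @^-1` UY `<=` sval @^-1` U by rewrite UY_preim.
have := (morphism_sval P).2 U (fun v => coord (vbasis {:V}) i (phi v)) U_open (phi_reg i).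
move=> /(regular_restr oU' s) r; apply: (regular_ext _ _ r) => // x /s Ux /=.
by rewrite chiE.
Qed.

Let kl_reg : @regular_map F (affine V) setT V (fun v => lam (kap v)).
Proof.
by apply: morphism_regular_map; apply: morphism_comp (morphism_linear kap) _;
  exact: morphism_affine.
Qed.

(** Inside the open image of U, A is the zero set of lam (kap v) - v, evaluated at
the normal form v. *)
Lemma slice_locally_closed : locally_closed A.
Proof.
apply: (locally_closed_zeros (U := UY) (theta := fun y => lam (kap (chi y)) - chi y)) => //.
  apply: regular_mapB => // i.
  have := regular_map_comp UY_open chi_reg openT (kl_reg i).
  by rewrite preimage_setT setIT.
move=> y; rewrite -(repK y) AE UYE; split=> -[Uy e]; split=> //.
  by rewrite chiE // e subrr.
by apply/eqP; rewrite -subr_eq0; move: e; rewrite chiE // => ->.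
Qed.

Let sig (t : W) : fs_quo q := q (exist P (lam t) (lam_P t)).
Let sigA t : A (sig t).
Proof. by apply/AE; split=> /=; rewrite ?phi_lam ?lamK //; exact: lam_U. Qed.

(** The inverse maps are kap of the normal form and the class of lam t.  The
former is regular because the normal form is an invariant regular map. *)
Lemma slice_isomorphic : fs_isomorphic (fs_sub A) (affine W).
Proof.
have AU y : A y -> UY y by rewrite -(repK y) AE UYE => -[].
exists (fun y => kap (chi (sval y))); split.
  apply: morphism_affine => i; have r := regular_map_linear kap UY_open chi_reg i.
  have := (morphism_sval A).2 _ _ UY_open r; apply: regular_sub => //; first exact: openT.
  by move=> y _; apply: AU; exact: svalP.
exists (fun t => exist A (sig t) (sigA t)); split.
- apply: morphism_into_sub; split=> [Z oZ|Z g oZ rg].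
    have m : @fs_morphism F (affine W) (fs_sub P) (fun t => exist P (lam t) (lam_P t)).
      by apply: morphism_into_sub; exact: morphism_affine.
    exact: (m.1 (q @^-1` Z)).
  have m : @fs_morphism F (affine W) (fs_sub P) (fun t => exist P (lam t) (lam_P t)).
    by apply: morphism_into_sub; exact: morphism_affine.
  exact: (m.2 (q @^-1` Z) (g \o q)).
- move=> [y Ay]; apply: eq_exist => /=.
  have [Uy e] : U (sval (rep y)) /\ lam (kap (phi (sval (rep y)))) = phi (sval (rep y)).
    by apply/AE; rewrite repK.
  rewrite -[RHS]repK; apply: phi_fib => //=.
- by move=> t /=; rewrite chiE ?phi_lam ?lamK //; exact: lam_U.
Qed.

End Slice.

(** * Row spans, flags and column spans *)
Section LinearAlgebra.
Context {F : fieldType}.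

Lemma unitmx_ker0 n (X : 'M[F]_n) :
  (forall a : 'rV_n, a *m X = 0 -> a = 0) -> X \in unitmx.
Proof.
move=> H; rewrite -row_free_unit -kermx_eq0; apply/eqP/row_matrixP => i.
by rewrite row0; apply: H; rewrite -row_mul mulmx_ker row0.
Qed.

Lemma invmx_mul n (g h : 'M[F]_n) : g \in unitmx -> h \in unitmx ->
  invmx (g *m h) = invmx h *m invmx g.
Proof.
move=> gU hU; have ghU : g *m h \in unitmx by rewrite unitmx_mul gU.
apply: (can_inj (mulmxK ghU)); rewrite mulVmx //.
by rewrite mulmxA mulmxKV // mulVmx.
Qed.

Lemma mem_row_span n N (M : 'M[F]_(n, N)) v :
  v \in <<row_tuple M>>%VS <-> exists a : 'rV_n, v = a *m M.
Proof.
split=> [/coord_span ->|[a ->]].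
  exists (\row_i coord (row_tuple M) i v); rewrite [RHS]mulmx_sum_row.
  by apply: eq_bigr => i _; rewrite mxE -tnth_nth tnth_mktuple.
rewrite mulmx_sum_row memv_suml // => i _; apply/memvZ/memv_span.
by apply/tnthP; exists i; rewrite tnth_mktuple.
Qed.

Lemma row_mem_span n N (M : 'M[F]_(n, N)) j : row j M \in <<row_tuple M>>%VS.
Proof. by apply/mem_row_span; exists (delta_mx 0 j); rewrite rowE. Qed.

Lemma free_rowsP n N (M : 'M[F]_(n, N)) :
  free (row_tuple M) <-> (forall a : 'rV_n, a *m M = 0 -> a = 0).
Proof.
have E (k : 'I_n -> F) : \sum_(i < n) k i *: (row_tuple M)`_i = (\row_i k i) *m M.
  rewrite mulmx_sum_row; apply: eq_bigr => i _.
  by rewrite mxE -tnth_nth tnth_mktuple.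
split=> [/freeP H a aM|H].
  apply/rowP => i; rewrite mxE; apply: (H (a 0)); rewrite E -[RHS]aM.
  by congr (_ *m _); apply/rowP => j; rewrite mxE.
apply/freeP => k; rewrite E => /H /rowP kE i.
by have := kE i; rewrite !mxE.
Qed.

Lemma span_mul_unit n N (g : 'M[F]_n) (M : 'M[F]_(n, N)) : g \in unitmx ->
  <<row_tuple (g *m M)>>%VS = <<row_tuple M>>%VS.
Proof.
move=> gU; apply/vspaceP => v; apply/idP/idP => /mem_row_span [a ->]; apply/mem_row_span.
  by exists (a *m g); rewrite mulmxA.
by exists (a *m invmx g); rewrite mulmxA mulmxKV.
Qed.

Lemma eq_span_unit n N (M M' : 'M[F]_(n, N)) : free (row_tuple M) ->
  <<row_tuple M>>%VS = <<row_tuple M'>>%VS -> exists2 g, g \in unitmx & M' = g *m M.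
Proof.
move=> /free_rowsP fM e.
have sub (A B : 'M[F]_(n, N)) : <<row_tuple A>>%VS = <<row_tuple B>>%VS ->
    exists g : 'M[F]_n, A = g *m B.
  move=> eAB; have /fin_all_exists [a Ha] : forall i, exists a : 'rV_n, row i A = a *m B.
    by move=> i; apply/mem_row_span; rewrite -eAB row_mem_span.
  exists (\matrix_i a i); apply/row_matrixP => i.
  by rewrite row_mul rowK.
have [g gE] := sub _ _ (esym e); have [g' g'E] := sub _ _ e.
exists g => //; have/mulmx1_unit [] // : g' *m g = 1%:M.
apply/row_matrixP => i; apply/eqP; rewrite -subr_eq0 -linearB /=; apply/eqP/fM.
by rewrite -row_mul mulmxBl -mulmxA -gE -g'E mul1mx subrr row0.
Qed.

Lemma mem_flag N k (v : 'rV[F]_N) :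
  v \in flag F N k <-> (forall c : 'I_N, (k <= c)%N -> v 0 c = 0).
Proof.
split=> [|H].
  rewrite /flag; set s := [seq _ | _ <- _ & _].
  move=> /(coord_span (X := in_tuple s)) -> c kc; rewrite summxE big1 // => i _.
  rewrite mxE.
  have /mapP [j jk ->] : s`_i \in s by exact: mem_nth.
  rewrite mxE eqxx /=; case: eqVneq => [cj|]; last by rewrite mulr0.
  by move: jk; rewrite mem_filter -cj ltnNge kc.
rewrite [v]row_sum_delta memv_suml // => j _.
have [jk|/H ->] := ltnP j k; last by rewrite scale0r mem0v.
apply/memvZ/memv_span/map_f; by rewrite mem_filter jk mem_enum.
Qed.

Lemma flag_mono N k l : (k <= l)%N -> (flag F N k <= flag F N l)%VS.
Proof.
move=> kl; apply/subvP => v /mem_flag H; apply/mem_flag => c lc.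
exact/H/(leq_trans kl).
Qed.

Lemma flag_full N k : (N <= k)%N -> flag F N k = fullv.
Proof.
move=> Nk; apply/vspaceP => v; rewrite memvf; apply/mem_flag => c.
by move=> /(leq_trans Nk); rewrite leqNgt ltn_ord.
Qed.

(** Modular law: the quotient of two consecutive members of the flag has dimension
at most 1. *)
Lemma dim_cap_flag N (W : {vspace 'rV[F]_N}) k :
  (\dim (W :&: flag F N k.+1) <= (\dim (W :&: flag F N k)).+1)%N.
Proof.
have fl : (flag F N k <= flag F N k.+1)%VS by exact: flag_mono.
have d1 : (\dim (flag F N k.+1) <= (\dim (flag F N k)).+1)%N.
  have [Nk|kN] := leqP N k; first by rewrite !flag_full ?leqW.
  pose c := Ordinal kN.
  have /dimvS /leq_trans -> // : (flag F N k.+1 <= flag F N k + <[delta_mx 0%R c]>)%VS.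
    apply/subvP => v /mem_flag H; apply/memv_addP.
    exists (v - v 0 c *: delta_mx 0 c).
      apply/mem_flag => d kd; rewrite !mxE eqxx /=.
      case: eqVneq => [->|ndc]; first by rewrite mulr1 subrr.
      rewrite mulr0 subr0 H // ltn_neqAle kd andbT.
      by apply: contra_neq ndc => e; apply: val_inj.
    exists (v 0 c *: delta_mx 0 c); last by rewrite subrK.
    by rewrite memvZ // memv_line.
  by rewrite (leq_trans (dimv_add_leqif _ _)) // dim_vline -[leqRHS]addn1 leq_add2l leq_b1.
have := dimv_sum_cap (W :&: flag F N k.+1) (flag F N k).
rewrite -capvA (capv_idPr fl) => e.
rewrite -(leq_add2r (\dim (flag F N k))) -e addSnnS addnC leq_add2l.
apply: leq_trans d1; apply: dimvS.
by rewrite subv_add capvSr.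
Qed.

Lemma last_nonzero N (v : 'rV[F]_N) c : v 0 c != 0 ->
  exists d : 'I_N, [/\ (c <= d)%N, v 0 d != 0 & forall d' : 'I_N, (d < d')%N -> v 0 d' = 0].
Proof.
move=> vc; case: (@arg_maxnP _ c (fun d => v 0 d != 0) (fun d => d : nat) vc) => d vd H.
exists d; split=> //; first exact: H.
move=> d' dd'; apply/eqP; apply: contraTT dd' => /H.
by rewrite -leqNgt.
Qed.

Lemma mulmx_sum_col a b (X : 'M[F]_(a, b)) (v : 'cV_b) :
  X *m v = \sum_j v j 0 *: col j X.
Proof.
apply/colP => i; rewrite mxE summxE; apply: eq_bigr => j _.
by rewrite !mxE mulrC.
Qed.

Lemma free_cols n (X : 'M[F]_n) :
  free [seq col j X | j <- enum 'I_n] <-> X \in unitmx.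
Proof.
have E (k : 'I_n -> F) :
    \sum_(i < n) k i *: [tuple col j X | j < n]`_i = X *m \col_i k i.
  rewrite mulmx_sum_col; apply: eq_bigr => i _.
  by rewrite mxE -tnth_nth tnth_mktuple.
have -> : [seq col j X | j <- enum 'I_n] = [tuple col j X | j < n] by [].
split=> [/freeP H|U].
  rewrite -unitmx_tr; apply: unitmx_ker0 => a aX.
  apply/rowP => j; rewrite [RHS]mxE; apply: (H (a 0)); rewrite E; apply: trmx_inj.
  rewrite trmx_mul linear0 -[RHS]aX; congr (_ *m _).
  by apply/rowP => i; rewrite !mxE.
apply/freeP => k; rewrite E => /(congr1 (mulmx (invmx X))).
rewrite mulKmx // mulmx0 => /colP kE i.
by have := kE i; rewrite !mxE.
Qed.

Lemma mem_cols_span n (P : pred 'I_n) (X : 'M[F]_n) v :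
  v \in <<[seq col j X | j <- enum 'I_n & P j]>>%VS <->
  exists2 c : 'cV_n, v = X *m c & forall j, ~~ P j -> c j 0 = 0.
Proof.
rewrite span_def big_map big_filter big_enum_cond /=; split.
  move=> /memv_sumP [vs vsP ->].
  have /fin_all_exists [c cE] : forall j, exists c, if P j then vs j = c *: col j X else c = 0.
    move=> j; case Pj: (P j); last by exists 0.
    by have /vlineP [c ->] := vsP j Pj; exists c.
  exists (\col_j c j).
    rewrite mulmx_sum_col [RHS](bigID P) /= [X in _ + X]big1 ?addr0 => [|j nP].
      by apply: eq_bigr => j Pj; rewrite mxE; have := cE j; rewrite Pj.
    by have := cE j; rewrite (negPf nP) mxE => ->; rewrite scale0r.
  by move=> j nP; have := cE j; rewrite (negPf nP) mxE.
move=> [c -> c0]; rewrite mulmx_sum_col (bigID P) /= [X in _ + X]big1 ?addr0.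
  by apply: memv_sumr => j _; rewrite memvZ // memv_line.
by move=> j /c0 ->; rewrite scale0r.
Qed.

End LinearAlgebra.

(** * Echelon matrices and Schubert cells *)
Section Pivots.
Context (n N : nat) (I : nsubset n N).

(** The order of the enumeration is immaterial: permuting the rows of a frame does
not change its span. *)
Definition pivot (j : 'I_n) : 'I_N :=
  enum_val (cast_ord (esym (eqP (svalP I))) j).

Lemma pivot_inj : injective pivot.
Proof. by move=> j l /enum_val_inj /cast_ord_inj. Qed.

Lemma pivot_in j : pivot j \in sval I.
Proof. exact: enum_valP. Qed.

Lemma pivotP c : c \in sval I -> exists j, c = pivot j.
Proof.
move=> cI; exists (cast_ord (eqP (svalP I)) (enum_rank_in cI c)).
by rewrite /pivot cast_ordK enum_rankK_in.
Qed.

Lemma sum_pivot (G : 'I_N -> nat) :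
  (\sum_(i in sval I) G i = \sum_(j < n) G (pivot j))%N.
Proof.
rewrite big_enum_val /= (reindex (cast_ord (esym (eqP (svalP I))))) //=.
by exists (cast_ord (eqP (svalP I))) => i _; rewrite ?cast_ordK ?cast_ordKV.
Qed.

Lemma card_below_pivot k :
  #|[pred i in sval I | (i < k)%N]| = #|[pred j : 'I_n | (pivot j < k)%N]|.
Proof.
rewrite -!sum1_card big_mkcondr /= sum_pivot [RHS]big_mkcond /=.
by apply: eq_bigr => j _.
Qed.

Lemma card_belowS (k : 'I_N) : #|[pred i in sval I | (i < k.+1)%N]| =
  ((k \in sval I) + #|[pred i in sval I | (i < k)%N]|)%N.
Proof.
rewrite [LHS](cardD1 k) !inE ltnS leqnn andbT; congr addn.
apply: eq_card => i; rewrite !inE ltnS [RHS]andbC [(i < k)%N]ltn_neqAle.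
by rewrite [RHS]andbC andbCA.
Qed.

End Pivots.

Section EchelonForms.
Context {F : fieldType} {n N : nat} (I : nsubset n N).
Local Notation pivot := (@pivot n N I).

Definition pivot_minor (M : 'M[F]_(n, N)) : 'M[F]_n := colsub pivot M.

(** Reduced echelon form with the pivot as the last nonzero entry of its row, since
the flag consists of the spans of the first coordinate vectors. *)
Definition echelon (M : 'M[F]_(n, N)) : Prop :=
  pivot_minor M = 1%:M /\
  forall j c, c \notin sval I -> (pivot j < c)%N -> M j c = 0.

Definition free_entries : {set 'I_n * 'I_N} :=
  [set t : 'I_n * 'I_N | (t.2 < pivot t.1)%N && (t.2 \notin sval I)].

Definition echelon_param (t : 'rV[F]_#|free_entries|) : 'M[F]_(n, N) :=
  \matrix_(j, c) ((c == pivot j)%:R +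
    \sum_k t 0 k * ((j, c) == enum_val k)%:R).

Definition echelon_coord (M : 'M[F]_(n, N)) : 'rV[F]_#|free_entries| :=
  \row_k M (enum_val k).1 (enum_val k).2.

Fact echelon_coord_linear : linear echelon_coord.
Proof. by move=> a M M'; apply/rowP => k; rewrite !mxE. Qed.

HB.instance Definition _ := GRing.isLinear.Build _ _ _ _ echelon_coord echelon_coord_linear.

Lemma card_free_entries : #|free_entries| = schubert_dim I.
Proof.
rewrite /schubert_dim (sum_pivot I) -sum1_card.
under [LHS]eq_bigl do rewrite inE.
rewrite -(pair_big_dep xpredT (fun (j : 'I_n) (c : 'I_N) => (c < pivot j)%N && (c \notin sval I))
  (fun _ _ => 1%N)) /=.
by apply: eq_bigr => j _; rewrite sum1_card; apply: eq_card => c.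
Qed.

Lemma echelon_paramK : cancel echelon_param echelon_coord.
Proof.
move=> t; apply/rowP => k; rewrite !mxE.
have: enum_val k \in free_entries by exact: enum_valP.
rewrite inE => /andP[_ nI].
have /negPf -> : (enum_val k).2 != pivot (enum_val k).1.
  by apply: contraNneq nI => ->; exact: pivot_in.
rewrite add0r (bigD1 k) //= -surjective_pairing eqxx mulr1 big1 ?addr0 // => l lk.
by rewrite (inj_eq enum_val_inj) eq_sym (negPf lk) mulr0.
Qed.

(** Outside the free entries, both conditions prescribe the value 1 at the pivot of
the row and 0 elsewhere. *)
Lemma echelon_paramP M : echelon_param (echelon_coord M) = M <-> echelon M.
Proof.
have E j c : echelon_param (echelon_coord M) j c =
    (c == pivot j)%:R + (if (j, c) \in free_entries then M j c else 0).
  rewrite mxE; congr +%R.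
  under eq_bigr do rewrite mxE.
  rewrite -(big_enum_val (fun t => M t.1 t.2 * ((j, c) == t)%:R)) /=.
  case: ifP => jc.
    rewrite (bigD1 (j, c)) //= eqxx mulr1 big1 ?addr0 // => t /andP[_ tn].
    by rewrite eq_sym (negPf tn) mulr0.
  rewrite big1 // => t tf; case: eqP => [e|]; last by rewrite mulr0.
  by move: tf; rewrite -e jc.
split=> [e|[M1 M0]].
  split.
    apply/matrixP => j l; rewrite mxE -e E !inE /= pivot_in andbF addr0.
    by rewrite (inj_eq (@pivot_inj _ _ I)) mxE eq_sym.
  move=> j c cI jc; rewrite -e E !inE /= cI andbT ltnNge (ltnW jc) addr0.
  by case: eqP => // cE; move: jc; rewrite cE ltnn.
apply/matrixP => j c; rewrite E inE /=.
have [/pivotP [l ->]|nI] := boolP (c \in sval I).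
  rewrite andbF addr0 (inj_eq (@pivot_inj _ _ I)).
  by move/matrixP: M1 => /(_ j l); rewrite !mxE eq_sym => ->.
have /negPf -> : c != pivot j by apply: contraNneq nI => ->; exact: pivot_in.
rewrite andbT add0r; case: ltngtP => [//|jc|cj]; first by rewrite M0.
by move: nI; rewrite (ord_inj cj) pivot_in.
Qed.

Lemma echelon_param_echelon t : echelon (echelon_param t).
Proof. by apply/echelon_paramP; rewrite echelon_paramK. Qed.

Lemma echelon_param_regular : @regular_map F (affine 'rV[F]_#|free_entries|) setT _ echelon_param.
Proof.
have oT : open [set: affine 'rV[F]_#|free_entries|] := openT.
apply/regular_map_mx => // j c.
apply: (@regular_ext _ (affine _) _ (fun t : 'rV[F]_#|free_entries| => (c == pivot j)%:R +
    \sum_k t 0 k * ((j, c) == enum_val k)%:R)) => // [t _|]; first by rewrite mxE.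
apply: regularD => //; first exact: regular_cst.
apply: regular_sum => // k; apply: regularM => //; last exact: regular_cst.
exact: (regular_map_mx _ oT).1 (@regular_map_id _ _) 0 k.
Qed.

Lemma pivot_minor_mul g M : pivot_minor (g *m M) = g *m pivot_minor M.
Proof. by rewrite /pivot_minor mulmx_colsub. Qed.

Lemma pivot_minor_free M : pivot_minor M \in unitmx -> free (row_tuple M).
Proof.
move=> U; apply/free_rowsP => a aM.
have : a *m pivot_minor M = 0 by rewrite /pivot_minor mulmx_colsub aM linear0.
by move/(congr1 (mulmx^~ (invmx (pivot_minor M)))); rewrite mulmxK // mul0mx.
Qed.

(** In a span W of Schubert type I, the last nonzero position c of any vector is in
I, because the dimension of the intersection with the flag jumps at c.  A vector
of W that vanishes on I is therefore 0, so the minor is invertible; and row j of the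
normal form, which vanishes on I except at its pivot, ends at its pivot.
Conversely, the rows of an echelon matrix whose pivot is before k form a basis of
the intersection with the k-th member of the flag. *)
Lemma schubert_cell_echelon (M : 'M[F]_(n, N)) : free (row_tuple M) ->
  (forall k, \dim (<<row_tuple M>> :&: flag F N k)%VS =
     #|[pred i in sval I | (i < k)%N]|) <->
  pivot_minor M \in unitmx /\ echelon (invmx (pivot_minor M) *m M).
Proof.
move=> fM; split=> [H|[U [E1 E0]] k].
  have lastI v c : v \in <<row_tuple M>>%VS -> v 0 c != 0 ->
      (forall d : 'I_N, (c < d)%N -> v 0 d = 0) -> c \in sval I.
    move=> vM vc vd.
    have : ~~ (\dim (<<row_tuple M>> :&: flag F N c.+1)%VS <=
               \dim (<<row_tuple M>> :&: flag F N c)%VS)%N.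
      rewrite -ltnNge (ltn_leqif (dimv_leqif_sup _)); last exact/capvS/flag_mono.
      apply/negP => /subvP /(_ v); rewrite !memv_cap vM /=.
      have -> : v \in flag F N c.+1 by apply/mem_flag.
      move=> /(_ isT) /mem_flag /(_ c (leqnn c)) v0.
      by rewrite v0 eqxx in vc.
    by rewrite !H card_belowS; case: (c \in sval I); rewrite // leqnn.
  have U : pivot_minor M \in unitmx.
    apply: unitmx_ker0 => a aM; apply: (free_rowsP M).1 => //.
    have aI l : (a *m M) 0 (pivot l) = 0.
      by move/matrixP: aM => /(_ 0 l); rewrite /pivot_minor mulmx_colsub !mxE.
    apply/rowP => c; rewrite [RHS]mxE; apply: contraTeq isT => nz; exfalso.
    have [d [_ dnz /lastI]] := last_nonzero nz.
    have vM : a *m M \in <<row_tuple M>>%VS by apply/mem_row_span; exists a.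
    move=> /(_ vM dnz) /pivotP [l dl].
    by rewrite dl aI eqxx in dnz.
  split=> //; have E1 : pivot_minor (invmx (pivot_minor M) *m M) = 1%:M.
    by rewrite pivot_minor_mul mulVmx.
  split=> // j c cI jc; set E := invmx _ *m M in E1 *.
  have vM : row j E \in <<row_tuple M>>%VS.
    by rewrite -(span_mul_unit M (g := invmx (pivot_minor M))) ?unitmx_inv // row_mem_span.
  have [//|nz] := eqVneq (E j c) 0.
  have nz' : row j E 0 c != 0 by rewrite [row j E 0 c]mxE.
  have [d [cd dnz /lastI]] := last_nonzero nz'.
  move=> /(_ vM dnz) /pivotP [l dl].
  have Ejl : E j (pivot l) = (j == l)%:R.
    by have /matrixP/(_ j l) := E1; rewrite mxE [RHS]mxE.
  move: dnz.
  rewrite [row j E 0 d]mxE dl Ejl; case: (eqVneq j l) => [jl|_]; last by rewrite eqxx.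
  by move: cd; rewrite dl -jl leqNgt jc.
set E := invmx _ *m M in E1 E0 *.
have fE : free (row_tuple E).
  by apply: pivot_minor_free; rewrite E1 unitmx1.
have -> : <<row_tuple M>>%VS = <<row_tuple E>>%VS.
  by rewrite span_mul_unit // unitmx_inv.
have EI j l : E j (pivot l) = (j == l)%:R.
  by have /matrixP/(_ j l) := E1; rewrite mxE [RHS]mxE.
pose s := [seq row j E | j <- enum 'I_n & (pivot j < k)%N].
have -> : (<<row_tuple E>> :&: flag F N k)%VS = <<s>>%VS.
  apply/eqP; rewrite eqEsubv; apply/andP; split; apply/subvP => v.
    rewrite memv_cap => /andP[/mem_row_span [a ->] /mem_flag ak].
    rewrite mulmx_sum_row memv_suml // => j _.
    have aj : a 0 j = (a *m E) 0 (pivot j).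
      rewrite mxE (bigD1 j) //= EI eqxx mulr1 big1 ?addr0 // => l lj.
      by rewrite EI (negPf lj) mulr0.
    have [jk|kj] := ltnP (pivot j) k; last by rewrite aj ak // scale0r mem0v.
    by apply/memvZ/memv_span/map_f; rewrite mem_filter jk mem_enum.
  apply/subvP/span_subvP => w /mapP [j]; rewrite mem_filter => /andP[jk _] ->.
  rewrite memv_cap row_mem_span; apply/mem_flag => c kc; rewrite [row j E 0 c]mxE.
  have jc : (pivot j < c)%N by exact: leq_trans kc.
  have [/pivotP [l cl]|cI] := boolP (c \in sval I); last by rewrite E0.
  rewrite cl EI; case: eqVneq => // jl.
  by move: jc; rewrite cl jl ltnn.
have fs : free s.
  have pE : perm_eq (s ++ [seq row j E | j <- enum 'I_n & ~~ (pivot j < k)%N])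
      (row_tuple E).
    rewrite -map_cat; have -> : tval (row_tuple E) = [seq row j E | j <- enum 'I_n] by [].
    by apply: perm_map; rewrite perm_filterC.
  by have := fE; rewrite -(perm_free pE); exact: catl_free.
rewrite (eqP fs) size_map card_below_pivot cardE size_filter.
by rewrite [in RHS]/enum_mem size_filter -enumT; apply: eq_count => j.
Qed.

End EchelonForms.

(** * The Schubert cells of the Grassmannian *)
Section GrassmannianCells.
Context {F : fieldType} {n N : nat}.

Definition frame_span (M : frames F n N) : gras_points F n N :=
  exist _ <<row_tuple (sval M)>>%VS (dim_row_span M).

Definition frame_of (M : 'M[F]_(n, N)) (fM : free (row_tuple M)) : frames F n N :=
  exist [set M | is_true (free (row_tuple M))] M fM.

Lemma frame_span_surj (W : gras_points F n N) : exists M, frame_span M = W.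
Proof.
case: W => W dW; pose t := tcast (eqP dW) (vbasis W).
have bW : <<t>>%VS = W by rewrite val_tcast; exact/span_basis/vbasisP.
have rt : row_tuple (\matrix_i tnth t i) = t.
  by apply: eq_from_tnth => i; rewrite tnth_mktuple rowK.
have fM : free (row_tuple (\matrix_i tnth t i)).
  by rewrite rt val_tcast; exact/basis_free/vbasisP.
exists (frame_of fM); apply: val_inj.
transitivity <<row_tuple (\matrix_i tnth t i)>>%VS => //; by rewrite rt bW.
Qed.

Lemma frame_span_eq (M M' : frames F n N) : frame_span M = frame_span M' <->
  exists2 g, g \in unitmx & sval M' = g *m sval M.
Proof.
split=> [/(congr1 val) /= e|[g gU e]]; first exact: eq_span_unit (svalP M) e.
by apply: val_inj => /=; rewrite e span_mul_unit.
Qed.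

Section Cell.
Context (I : nsubset n N).

Let U : set (affine 'M[F]_(n, N)) := [set M | pivot_minor I M \in unitmx].

Lemma pivot_minor_regular :
  @regular_map F (affine 'M[F]_(n, N)) setT _ (pivot_minor I).
Proof.
have oT : open [set: affine 'M[F]_(n, N)] := openT.
apply/regular_map_mx => // i j.
apply: (@regular_ext _ (affine _) _ (fun M : 'M[F]_(n, N) => M i (pivot I j))) => //.
  by move=> M _; rewrite mxE.
exact: (regular_map_mx _ oT).1 (@regular_map_id _ _) i _.
Qed.

Let U_open : open U.
Proof.
have oT : open [set: affine 'M[F]_(n, N)] := openT.
have := regular_nz oT (regular_det oT pivot_minor_regular).
rewrite setTI; congr (open _); apply/seteqP.
by split=> M; rewrite /U /= unitmxE unitfE.
Qed.

Let normalize (M : 'M[F]_(n, N)) := invmx (pivot_minor I M) *m M.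

Let normalize_regular : @regular_map F (affine 'M[F]_(n, N)) U _ normalize.
Proof.
have s : U `<=` setT by [].
apply: regular_map_mulmx => //.
  by apply: regular_map_invmx => //; exact: regular_map_restr pivot_minor_regular.
by apply: regular_map_restr (@regular_map_id _ _).
Qed.

Let cellE (M : frames F n N) : schubert_cell I (frame_span M) <->
  U (sval M) /\ echelon_param (echelon_coord I (normalize (sval M))) = normalize (sval M).
Proof.
rewrite /schubert_cell /= (schubert_cell_echelon I (svalP M)).
by split=> -[UM /echelon_paramP e].
Qed.

Let norm_inv (M M' : frames F n N) : frame_span M = frame_span M' -> U (sval M) ->
  U (sval M') /\ normalize (sval M) = normalize (sval M').
Proof.
move=> /frame_span_eq [g gU ->] UM; split; rewrite /U /normalize /= pivot_minor_mul.
  by rewrite unitmx_mul gU.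
by rewrite invmx_mul // !mulmxA mulmxKV.
Qed.

Let norm_fib (M M' : frames F n N) : U (sval M) -> sval M' = normalize (sval M) ->
  frame_span M' = frame_span M.
Proof.
move=> UM e; apply/esym/frame_span_eq.
by exists (invmx (pivot_minor I (sval M))); rewrite ?unitmx_inv.
Qed.

Let param_U t : U (@echelon_param F _ _ I t).
Proof. by rewrite /U /= (echelon_param_echelon t).1 unitmx1. Qed.

Let param_norm t : normalize (@echelon_param F _ _ I t) = echelon_param t.
Proof. by rewrite /normalize (echelon_param_echelon t).1 invmx1 mul1mx. Qed.

Let param_free (t : 'rV[F]_#|free_entries I|) :
  [set M : 'M[F]_(n, N) | is_true (free (row_tuple M))] (echelon_param t).
Proof. exact/pivot_minor_free/param_U. Qed.

Lemma schubert_locally_closed : locally_closed (@schubert_cell F n N I).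
Proof.
exact: (slice_locally_closed frame_span_surj U_open normalize_regular norm_inv
  (@echelon_param_regular F _ _ I) cellE).
Qed.

Lemma schubert_isomorphic :
  fs_isomorphic (fs_sub (@schubert_cell F n N I)) (affine 'rV[F]_#|free_entries I|).
Proof.
exact: (slice_isomorphic frame_span_surj U_open normalize_regular norm_inv norm_fib
  (@echelon_param_regular F _ _ I) param_free param_U param_norm (@echelon_paramK F _ _ I) cellE).
Qed.

Lemma schubert_nonempty : @schubert_cell F n N I !=set0.
Proof.
exists (frame_span (frame_of (param_free 0))); apply/cellE; split; first exact: param_U.
by rewrite /= param_norm echelon_paramK.
Qed.

End Cell.
End GrassmannianCells.

Section SchubertPartition.
Context {F : fieldType} {n N : nat}.

Lemma schubert_disjoint (I J : nsubset n N) (W : gras_points F n N) :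
  schubert_cell I W -> schubert_cell J W -> I = J.
Proof.
move=> HI HJ; apply: val_inj; apply/setP => i.
have := card_belowS J i; rewrite -!HJ !HI card_belowS.
by move/addIn; case: (i \in sval I); case: (i \in sval J).
Qed.

(** I is the set of the positions where the dimension of the intersection with the
flag jumps. *)
Lemma schubert_cover (W : gras_points F n N) : exists I, schubert_cell I W.
Proof.
case: W => W dW.
pose d k := \dim (W :&: flag F N k)%VS.
pose I : {set 'I_N} := [set i : 'I_N | d i.+1 != d i]%SET.
have dS k : d k.+1 = ((d k.+1 != d k) + d k)%N.
  have := dim_cap_flag W k; rewrite -/(d k) -/(d k.+1).
  have : (d k <= d k.+1)%N by apply/dimvS/capvS/flag_mono.
  by case: eqVneq => [-> //|]; rewrite leq_eqVlt eq_sym => /negPf -> /= kl lk;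
     apply/eqP; rewrite eqn_leq lk.
have d0 : d 0%N = 0%N.
  apply/eqP; rewrite dimv_eq0 -subv0; apply/subvP => v.
  rewrite memv_cap => /andP[_ /mem_flag v0]; rewrite memv0; apply/eqP/rowP => c.
  by rewrite v0 // mxE.
have below k : (k <= N)%N -> d k = #|[pred i in I | (i < k)%N]|.
  elim: k => [_|k IH kN].
    by rewrite d0; apply/esym/eq_card0 => i; rewrite !inE andbF.
  pose c := Ordinal kN.
  rewrite dS [X in (_ + X)%N]IH 1?ltnW // [RHS](cardD1 c) !inE /= ltnSn andbT.
  congr addn.
  apply: eq_card => i; rewrite !inE /= ltnS [(i < k)%N]ltn_neqAle -(inj_eq val_inj) /=.
  by rewrite andbCA.
have cI : #|I| == n.
  apply/eqP; rewrite -[RHS](eqP dW); transitivity (d N); last by rewrite /d flag_full // capvf.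
  by rewrite below //; apply: eq_card => i; rewrite !inE ltn_ord andbT.
exists (exist (fun I : {set 'I_N} => #|I| == n) I cI) => k /=.
have [kN|Nk] := leqP k N; first exact: below.
rewrite (flag_full (ltnW Nk)) -(flag_full (leqnn N)) [LHS](below N) //.
by apply: eq_card => i; rewrite !inE !(leq_trans (ltn_ord i)) // ltnW.
Qed.

End SchubertPartition.

(** * The trivial bundle and its natural cells *)
Section TrivialBundle.
Context {F : fieldType} (B : fspace F) (r : nat).

Let tot := fs_prod B (affine 'rV[F]_r).

Definition trivial_bundle : vbundle B r.
Proof.
refine (@VBundle F B r tot fst (morphism_fst B (affine 'rV[F]_r)) unit
  (fun=> setT) (fun _ => snd) (fun=> openT) _ _ _).
- by rewrite bigcup_const //; exists tt.
- move=> i; split.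
    apply: (@morphism_pair F (fs_sub [set: B]) (affine 'rV[F]_r)
      (fs_sub (@fst B 'rV[F]_r @^-1` [set: B] : set tot))
      (fun e => exist [set: B] (sval e).1 (svalP e)) (fun e => (sval e).2)).
      apply: morphism_into_sub.
      exact: (morphism_comp (morphism_sval _) (morphism_fst B (affine 'rV[F]_r))).
    exact: (morphism_comp (morphism_sval _) (morphism_snd B (affine 'rV[F]_r))).
  exists (fun z => exist (fst @^-1` setT) (sval z.1, z.2) I); split.
  + apply: morphism_into_sub.
    apply: (@morphism_pair F B (affine 'rV[F]_r) (fs_prod (fs_sub [set: B]) (affine 'rV[F]_r))
      (fun z => sval z.1) (fun z => z.2)).
      exact: (morphism_comp (morphism_fst _ _) (morphism_sval _)).
    exact: morphism_snd.
  + by move=> [[b v] h]; apply: eq_exist.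
  + by move=> [[b h] v] /=; congr pair; apply: eq_exist.
- by move=> i j b _ _; exists 1%:M => [|e _]; rewrite ?unitmx1 ?mulmx1.
Defined.

(** The total space over A is the product of A and the fibre, and the product of
two affine spaces is affine. *)
Lemma trivial_bundle_cell (A : set B) (W : vectType F) :
  fs_isomorphic (fs_sub A) (affine W) ->
  fs_isomorphic (fs_sub (@vb_proj F B r trivial_bundle @^-1` A))
    (affine (W * 'rV[F]_r)%type).
Proof.
move=> [f [mf [g [mg fK gK]]]].
have mproj := morphism_sval (@vb_proj F B r trivial_bundle @^-1` A).
pose base (e : fs_sub (@vb_proj F B r trivial_bundle @^-1` A)) : fs_sub A :=
  exist A (sval e).1 (svalP e).
have mbase : fs_morphism base.
  apply: morphism_into_sub.
  exact: (morphism_comp mproj (morphism_fst B (affine 'rV[F]_r))).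
exists (fun e => (f (base e), (sval e).2)); split.
  apply: morphism_affine; apply: regular_map_pair; first exact: openT.
    exact: (morphism_regular_map (morphism_comp mbase mf)).
  exact: (morphism_regular_map (morphism_comp mproj (morphism_snd B (affine 'rV[F]_r)))).
exists (fun w => exist (@vb_proj F B r trivial_bundle @^-1` A) (sval (g w.1), w.2) (svalP (g w.1))).
split.
- apply: morphism_into_sub.
  apply: (@morphism_pair _ B (affine 'rV[F]_r) (affine (W * 'rV[F]_r)%type)
    (fun w => sval (g w.1)) (fun w => w.2)).
    apply: (@morphism_comp _ _ (fs_sub A) _ (fun w : affine (W * 'rV[F]_r)%type => g w.1))
      (morphism_sval _).
    exact: (morphism_comp (@morphism_linear _ (W * 'rV[F]_r)%type W fst) mg).
  exact: (@morphism_linear _ (W * 'rV[F]_r)%type _ snd).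
- by move=> [[b v] h]; apply: eq_exist; rewrite /= fK.
- move=> [w v]; congr pair; rewrite -[RHS]gK; congr f; rewrite /base /=.
  by case: (g w) => b h; apply: eq_exist.
Qed.

End TrivialBundle.

Section NaturalCells.
Context {F : fieldType} {n N r : nat}.

Lemma dim_pair (V W : vectType F) : \dim {: (V * W)%type} = (\dim {:V} + \dim {:W})%N.
Proof. by rewrite !dimvf. Qed.

Lemma dim_mx a b : \dim {: 'M[F]_(a, b)} = (a * b)%N.
Proof. by rewrite dimvf dim_matrix. Qed.

Lemma trivial_bundle_cells :
  cell_decomposition (natural_cell (E := @trivial_bundle F (Gras F n N) r))
    (natural_dim (n := n) (N := N) r).
Proof.
split=> [|I|I].
- split.
  + apply/seteqP; split=> // -[W v] _.
    by have [I WI] := schubert_cover W; exists I.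
  + by move=> I J _ _ [[W v] [WI WJ]]; exact: schubert_disjoint WI WJ.
  + move=> I _; have [W WI] := schubert_nonempty (F := F) I.
    by exists (W, 0).
- apply: locally_closed_preimage; first exact: vb_proj_morphism.
  exact: schubert_locally_closed.
- apply: fs_isomorphic_trans (affine_isomorphic _).
    exact: trivial_bundle_cell (schubert_isomorphic I).
  by rewrite dim_pair !dim_mx !mul1n /natural_dim card_free_entries.
Qed.

End NaturalCells.

(** * The greedy walk through the vectors A^r b_k *)
Lemma downward_ind (N : nat) (P : nat -> Prop) :
  P N -> (forall t, (t < N)%N -> P t.+1 -> P t) -> forall t, (t <= N)%N -> P t.
Proof.
move=> PN PS t tN; rewrite -(subKn tN); elim: (N - t)%N (leq_subr t N) => [|s IH] sN.
  by rewrite subn0.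
apply: PS; first by rewrite ltn_subrL (leq_trans _ sN).
by rewrite subnSK //; apply: IH; exact: ltnW.
Qed.

Section Walk.
Context {F : fieldType} {m n : nat} (N : nat).
Implicit Types (w : pred nat) (A : 'M[F]_n) (B : 'M[F]_(n, m)) (t : nat).

(** Past the last column of B the input is 0, so that a walk running out of columns
discards every further vector. *)
Definition input B (k : nat) : 'cV[F]_n :=
  if insub k is Some k then col k B else 0.

(** The walk decreases from N to 0, and w t tells whether the vector read at step
t + 1 is kept.  [skips w t] is the number of vectors discarded so far, that is, the
index of the current column of B. *)
Definition skips w t := count (predC w) (iota t (N - t)).

(** By recursion on the number s = N - t of decisions taken. *)
Fixpoint walk w A B (s : nat) : 'cV[F]_n :=
  if s is s'.+1 then
    if w (N - s)%N then A *m walk w A B s' else input B (skips w (N - s))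
  else input B 0.

(** The vector read when the decisions w u with t <= u have been taken. *)
Definition candidate w A B t := walk w A B (N - t).

Definition emitted w A B t := [seq candidate w A B u.+1 | u <- iota t (N - t) & w u].

Definition greedy w A B := forall t, (t < N)%N ->
  w t = (candidate w A B t.+1 \notin <<emitted w A B t.+1>>%VS).

Lemma skipsN w : skips w N = 0%N.
Proof. by rewrite /skips subnn. Qed.

Lemma skipsS w t : (t < N)%N -> skips w t = (~~ w t + skips w t.+1)%N.
Proof. by move=> tN; rewrite /skips -(subnSK tN). Qed.

Lemma candidateN w A B : candidate w A B N = input B 0.
Proof. by rewrite /candidate subnn. Qed.

Lemma candidateS w A B t : (t < N)%N -> candidate w A B t =
  if w t then A *m candidate w A B t.+1 else input B (skips w t).
Proof. by move=> tN; rewrite /candidate -(subnSK tN) /= (subnSK tN) (subKn (ltnW tN)). Qed.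

Lemma emittedN w A B : emitted w A B N = [::].
Proof. by rewrite /emitted subnn. Qed.

Lemma emittedS w A B t : (t < N)%N -> emitted w A B t =
  if w t then candidate w A B t.+1 :: emitted w A B t.+1 else emitted w A B t.+1.
Proof. by move=> tN; rewrite /emitted -(subnSK tN) /=; case: (w t). Qed.

Lemma emitted_sub w A B t : (t <= N)%N ->
  (<<emitted w A B t>> <= <<emitted w A B 0>>)%VS.
Proof.
elim: t => [//|t IH] tN; apply: subv_trans (IH (ltnW tN)).
rewrite [X in (_ <= <<X>>)%VS]emittedS //; case: (w t) => //.
by rewrite span_cons addvSr.
Qed.

(** The walk down to t only looks at the decisions from t on.  This gives both the
existence and the uniqueness of the greedy walk by downward recursion. *)
Lemma walk_agree w w' A B t : (t <= N)%N ->
  (forall u, (t <= u < N)%N -> w u = w' u) ->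
  [/\ skips w t = skips w' t, candidate w A B t = candidate w' A B t &
      emitted w A B t = emitted w' A B t].
Proof.
move: t; apply: downward_ind => [_|t tN IH e].
  by rewrite !skipsN !candidateN !emittedN.
have [|sE cE eE] := IH; first by move=> u /andP[tu uN]; rewrite e // (ltnW tu).
have wt : w t = w' t by rewrite e // leqnn tN.
by rewrite !(skipsS _ tN) !(candidateS _ _ _ tN) !(emittedS _ _ _ tN) !(skipsS _ tN) wt sE cE eE.
Qed.

Lemma greedy_ex A B : exists w, greedy w A B.
Proof.
suff [w H] : exists w, forall t, (0 <= t < N)%N ->
    w t = (candidate w A B t.+1 \notin <<emitted w A B t.+1>>%VS) by exists w.
apply: (@downward_ind N (fun s => exists w, forall t, (s <= t < N)%N ->
    w t = (candidate w A B t.+1 \notin <<emitted w A B t.+1>>%VS))) => //.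
  by exists xpredT => t /andP[Nt tN]; have := leq_trans tN Nt; rewrite ltnn.
move=> s sN [w H].
pose w' u := if u == s then candidate w A B s.+1 \notin <<emitted w A B s.+1>>%VS else w u.
exists w' => t /andP[st tN].
have agree u : (t.+1 <= u < N)%N -> w u = w' u.
  by rewrite /w' => /andP[tu _]; rewrite gtn_eqF // (leq_ltn_trans st).
have [_ <- <-] := walk_agree A B tN agree.
rewrite /w'; case: eqVneq => [-> //|ts]; apply: H.
by rewrite tN andbT ltn_neqAle eq_sym ts.
Qed.

Lemma greedy_agree w w' A B : (forall t, (t < N)%N -> w t = w' t) ->
  greedy w A B -> greedy w' A B.
Proof.
move=> e gw t tN; rewrite -e // gw //.
have [|_ -> -> //] := walk_agree (w := w) (w' := w') A B tN.
by move=> u /andP[_ /e].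
Qed.

Lemma greedy_uniq w w' A B : greedy w A B -> greedy w' A B ->
  forall t, (t < N)%N -> w t = w' t.
Proof.
move=> gw gw' t tN.
suff: forall u, (0 <= u < N)%N -> w u = w' u by apply.
apply: (@downward_ind N (fun s => forall u, (s <= u < N)%N -> w u = w' u)) => //.
  by move=> u /andP[Nt uN]; have := leq_trans uN Nt; rewrite ltnn.
move=> s sN IH u; rewrite leq_eqVlt => /andP[/orP[/eqP <- _|su uN]]; last first.
  by apply: IH; rewrite su.
rewrite gw // gw' //.
by have [_ -> ->] := walk_agree A B sN IH.
Qed.

Lemma greedy_free w A B t : greedy w A B -> (t <= N)%N -> free (emitted w A B t).
Proof.
move=> gw; move: t; apply: downward_ind => [|t tN IH].
  by rewrite emittedN nil_free.
by rewrite emittedS //; case: ifP => // wt; rewrite free_cons IH -gw // wt.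
Qed.

Lemma size_emitted w A B : (size (emitted w A B 0) + skips w 0 = N)%N.
Proof. by rewrite size_map size_filter count_predC size_iota subn0. Qed.

Lemma candidate_stopped w A B t : (t <= N)%N -> (m <= skips w t)%N -> candidate w A B t = 0.
Proof.
have in0 k : (m <= k)%N -> input B k = 0.
  by rewrite /input; case: insubP => [i km _|//]; rewrite leqNgt km.
move: t; apply: downward_ind => [|t tN IH].
  by rewrite skipsN candidateN => /in0.
rewrite candidateS //; case: ifP => [wt|_ /in0 //].
by rewrite skipsS // wt => /IH ->; rewrite mulmx0.
Qed.

(** The number of discarded vectors takes every value in between, so column k of B is
read for every k up to that number. *)
Lemma skips_surj w t k : (t <= N)%N -> (k <= skips w t)%N ->
  exists u, [/\ (t <= u <= N)%N, (u < N)%N ==> ~~ w u & skips w u = k].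
Proof.
move: t; apply: downward_ind => [|t tN IH].
  rewrite skipsN leqn0 => /eqP ->; exists N; split.
  - by rewrite leqnn.
  - by rewrite ltnn.
  - exact: skipsN.
have [kt|] := leqP k (skips w t.+1).
  move=> _; have [u [/andP[tu uN] wu su]] := IH kt; exists u; split=> //.
  by rewrite uN (ltnW tu).
move=> tk kt; exists t; move: kt tk; rewrite skipsS //.
case: (w t) => /=; first by move=> a /leq_trans /(_ a); rewrite ltnn.
rewrite add1n => a b; have -> : k = (skips w t.+1).+1 by apply/eqP; rewrite eqn_leq a.
by split; rewrite // ?leqnn ?(ltnW tN) ?tN.
Qed.

Lemma candidate_input w A B u : (u <= N)%N -> (u < N)%N ==> ~~ w u ->
  candidate w A B u = input B (skips w u).
Proof.
rewrite leq_eqVlt => /orP[/eqP ->|uN]; first by rewrite candidateN skipsN.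
by rewrite uN candidateS // => /negPf ->.
Qed.

(** At most n independent vectors can be kept.  If fewer were, at least m of the
N = m + n - 1 vectors would be discarded, so every column of B would be read and the
last vector read would be 0.  The span of the kept vectors would then contain
all vectors read; hence it would be A-stable and contain the columns of B, so it
would be the whole space. *)
Lemma greedy_count w A B : N.+1 = (m + n)%N -> greedy w A B ->
  (forall Z : {vspace 'cV[F]_n}, (forall k, col k B \in Z) ->
    (forall v, v \in Z -> A *m v \in Z) -> Z = fullv) ->
  size (emitted w A B 0) = n.
Proof.
move=> Nmn gw cc; have fr := greedy_free gw (leq0n N).
have szn : (size (emitted w A B 0) <= n)%N.
  by rewrite -(eqP fr) (leq_trans (dimvS (subvf _))) // dim_mx muln1.
apply/eqP; rewrite eqn_leq szn leqNgt; apply/negP => lt.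
have ms : (m <= skips w 0)%N.
  move: lt; rewrite -(ltn_add2r (skips w 0)) size_emitted Nmn addnC.
  by rewrite leq_add2l.
suff Zf : <<emitted w A B 0>>%VS = fullv.
  by move: lt; rewrite -(eqP fr) Zf dim_mx muln1 ltnn.
have candZ t : (t <= N)%N -> candidate w A B t \in <<emitted w A B 0>>%VS.
  case: t => [|t] tN; first by rewrite candidate_stopped // mem0v.
  have /subvP sub := emitted_sub w A B tN; have [wt|nwt] := boolP (w t); last first.
    by apply: sub; move: nwt; rewrite gw // negbK.
  have /subvP := emitted_sub w A B (ltnW tN); apply.
  by rewrite emittedS // wt memv_span // inE eqxx.
apply: cc => [k|v].
  have [|u [/andP[_ uN] wu su]] := @skips_surj w 0 k (leq0n N).
    by rewrite (leq_trans _ ms) // ltnW.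
  have := candZ u uN; rewrite candidate_input // su /input.
  by case: insubP => [i _ ik|/negP []//]; rewrite (ord_inj ik).
rewrite -[A *m v]/(mulmx A v) => vZ.
have /subvP : (linfun (mulmx A : 'cV_n -> 'cV_n) @: <<emitted w A B 0>> <= <<emitted w A B 0>>)%VS.
  rewrite limg_span; apply/span_subvP => x /mapP [y /mapP [u]].
  rewrite mem_filter mem_iota add0n subn0 => /andP[wu /andP[_ uN]] -> ->.
  by rewrite lfunE /=; have := candZ u (ltnW uN); rewrite (candidateS _ _ _ uN) wu.
by move/(_ (A *m v)); apply; apply/memv_imgP; exists v; rewrite ?lfunE.
Qed.

(** The bound on the exponent is what places the vectors read among the columns of
the controllability matrix, which stops at A^(n-1). *)
Lemma candidate_power w A B t : (t <= N)%N -> exists2 r, (r <= count w (iota t (N - t)))%N &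
  exists k, candidate w A B t = A ^+ r *m input B k.
Proof.
move: t; apply: downward_ind => [|t tN [r rc [k e]]].
  by exists 0%N => //; exists 0%N; rewrite expr0 mul1mx candidateN.
rewrite candidateS // -(subnSK tN) /=; case: (w t); last first.
  by exists 0%N => //; exists (skips w t); rewrite expr0 mul1mx.
by exists r.+1 => //; exists k; rewrite e exprS mulmxA.
Qed.

(** The walk is equivariant, so the greedy decisions depend only on the orbit. *)
Lemma candidate_mul w A B g t : g \in unitmx -> (t <= N)%N ->
  candidate w (g *m A *m invmx g) (g *m B) t = g *m candidate w A B t.
Proof.
move=> gU; have inE k : input (g *m B) k = g *m input B k.
  by rewrite /input; case: insubP => [i _ _|_]; rewrite ?mulmx0 // colE -mulmxA -colE.
move: t; apply: downward_ind => [|t tN IH]; first by rewrite !candidateN inE.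
by rewrite !(candidateS _ _ _ tN); case: (w t); rewrite // IH !mulmxA mulmxKV.
Qed.

Lemma greedy_mul w A B g : g \in unitmx ->
  greedy w A B -> greedy w (g *m A *m invmx g) (g *m B).
Proof.
move=> gU gw t tN; rewrite candidate_mul // gw //; congr (~~ _).
pose h := linfun (mulmx g : 'cV[F]_n -> 'cV[F]_n).
have hE v : h v = g *m v by rewrite lfunE.
have -> : emitted w (g *m A *m invmx g) (g *m B) t.+1 = map h (emitted w A B t.+1).
  rewrite /emitted -map_comp; apply/eq_in_map => u.
  rewrite mem_filter mem_iota subnKC // => /andP[_ /andP[_ uN]] /=.
  by rewrite candidate_mul ?hE.
rewrite -limg_span -hE; apply/idP/idP => [|/memv_imgP [v vZ]]; first exact: memv_img.
rewrite !hE => /(congr1 (mulmx (invmx g))); rewrite !mulKmx // => ->; exact: vZ.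
Qed.

End Walk.

(** * Controllability *)
Section Controllability.
Context {F : fieldType} {m n p : nat} (A : 'M[F]_n) (B : 'M[F]_(n, m)) (C : 'M[F]_(p, n)).

Lemma controllable_stable_full (Z : {vspace 'cV[F]_n}) :
  completely_controllable (A, B, C) -> (forall k, col k B \in Z) ->
  (forall v, v \in Z -> A *m v \in Z) -> Z = fullv.
Proof.
move=> cc BZ AZ; apply/vspaceP => v; rewrite memvf.
have /row_freeP [X cX] : row_free (ctrl_mx (A, B, C)) by exact/eqP.
rewrite -[v]mul1mx -cX -mulmxA [_ *m (X *m v)]mulmx_sum_col.
apply: memv_suml => t _; apply: memvZ.
have -> : col t (ctrl_mx (A, B, C)) = A ^+ tagnat.sig1 t *m col (tagnat.sig2 t) B.
  by rewrite colE [in RHS]colE mulmxA -colE -[RHS]colE; apply/colP => i; rewrite !mxE.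
elim: (val (tagnat.sig1 t)) => [|k IH]; first by rewrite expr0 mul1mx.
by rewrite exprS -[A * _]/(A *m _) -mulmxA AZ.
Qed.

Lemma controllable_ker0 :
  (forall u : 'rV[F]_n, (forall (j : 'I_n) (k : 'I_m), u *m (A ^+ j *m col k B) = 0) -> u = 0) ->
  completely_controllable (A, B, C).
Proof.
move=> H; apply/eqP; rewrite -[_ == n]/(row_free _) -kermx_eq0; apply/eqP/row_matrixP => i.
rewrite row0; apply: H => j k.
have uK : row i (kermx (ctrl_mx (A, B, C))) *m ctrl_mx (A, B, C) = 0.
  by rewrite -row_mul mulmx_ker row0.
set u := row i _ in uK *.
have /eq_mxrowP/(_ j) e : \mxrow_(l < n) (u *m (A ^+ l *m B)) =
    \mxrow_(l < n) (0 : 'M[F]_(1, m)).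
  by rewrite -mul_mxrow [LHS]uK; apply/matrixP => a b; rewrite !mxE.
by rewrite colE !mulmxA -[u *m _ *m B]mulmxA e mul0mx.
Qed.

End Controllability.

(** * Canonical forms of systems *)
Section Membership.
Context {n N : nat} (I : nsubset n N).

(** Membership in I as a sequence of decisions; it is false outside [0, N). *)
Definition nat_mem : pred nat := [pred t | t \in [seq val c | c <- enum (sval I)]].

Lemma nat_mem_ord (c : 'I_N) : nat_mem c = (c \in sval I).
Proof. by rewrite /nat_mem inE (mem_map val_inj) mem_enum. Qed.

Lemma nat_memP t : nat_mem t -> exists j, t = pivot I j.
Proof.
move=> /mapP [c]; rewrite mem_enum => /pivotP [j cj] ->.
by exists j; rewrite -cj.
Qed.

Lemma nat_mem_pivot j : nat_mem (pivot I j).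
Proof. by rewrite nat_mem_ord pivot_in. Qed.

Lemma nat_mem_lt t : nat_mem t -> (t < N)%N.
Proof. by move=> /nat_memP [j ->]. Qed.

Lemma count_nat_mem : count nat_mem (iota 0 N) = n.
Proof.
rewrite -val_enum_ord count_map -[RHS](eqP (svalP I)) cardE size_filter.
by rewrite -enumT; apply: eq_count => c; rewrite /= nat_mem_ord.
Qed.

(** Of the N = m + n - 1 vectors with a recorded decision, n are kept. *)
Lemma skips_nat_mem m : N.+1 = (m + n)%N -> (skips N nat_mem 0).+1 = m.
Proof.
have := count_predC nat_mem (iota 0 N); rewrite count_nat_mem size_iota => e Nmn.
apply/eqP; rewrite -(eqn_add2r n) -Nmn -{2}e /skips subn0.
by rewrite addSn addnC.
Qed.

Lemma emitted_perm {F : fieldType} m (A : 'M[F]_n) (B : 'M[F]_(n, m)) t : (t <= N)%N ->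
  perm_eq (emitted N nat_mem A B t)
   [seq candidate N nat_mem A B (pivot I j).+1 | j <- enum 'I_n & (t <= pivot I j)%N].
Proof.
move=> tN; set s := [seq j <- _ | _].
have -> : [seq candidate N nat_mem A B (pivot I j).+1 | j <- s] =
    [seq candidate N nat_mem A B u.+1 | u <- [seq val (pivot I j) | j <- s]].
  by rewrite -map_comp.
apply: perm_map; apply: uniq_perm.
- exact/filter_uniq/iota_uniq.
- rewrite map_inj_uniq; first exact/filter_uniq/enum_uniq.
  by move=> j l /val_inj /pivot_inj.
move=> u; rewrite mem_filter mem_iota subnKC //; apply/idP/mapP.
  by move=> /andP[/nat_memP [j ->] /andP[tj _]]; exists j; rewrite // mem_filter tj mem_enum.
move=> [j]; rewrite mem_filter => /andP[tj _] ->.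
by rewrite nat_mem_pivot tj ltn_ord.
Qed.

End Membership.

Section CanonicalForms.
Context {F : fieldType} {m n N : nat} (I : nsubset n N).
Context (Nmn : N.+1 = (m + n)%N).
Implicit Types (A : 'M[F]_n) (B : 'M[F]_(n, m)).
Local Notation w := (nat_mem I).
Local Notation pivot := (@pivot n N I).
Local Notation candidate := (candidate N w).
Local Notation skips := (skips N w).

(** The kept vectors as the columns of a square matrix: the change of basis to the
canonical form. *)
Definition walk_minor A B : 'M[F]_n := \matrix_(i, j) candidate A B (pivot j).+1 i 0.

Lemma col_walk_minor A B j : col j (walk_minor A B) = candidate A B (pivot j).+1.
Proof. by apply/colP => i; rewrite !mxE. Qed.

Lemma mem_emitted A B t v : (t <= N)%N -> v \in <<emitted N w A B t>>%VS <->
  exists2 c : 'cV_n, v = walk_minor A B *m c & forall j, (pivot j < t)%N -> c j 0 = 0.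
Proof.
move=> tN; rewrite (eq_span (perm_mem (emitted_perm I A B tN))).
under eq_map do rewrite -col_walk_minor.
rewrite mem_cols_span; split=> -[c vc c0]; exists c => // j.
  by rewrite ltnNge; exact: c0.
by rewrite -ltnNge; exact: c0.
Qed.

Lemma free_emitted A B : free (emitted N w A B 0) <-> walk_minor A B \in unitmx.
Proof.
rewrite -free_cols (perm_free (emitted_perm I A B (leq0n N))) filter_predT.
by under eq_map do rewrite -col_walk_minor.
Qed.

(** In the basis of the kept vectors, a discarded vector only involves vectors kept
before it, that is, those with pivots to its right. *)
Lemma greedyP A B : greedy N w A B <-> walk_minor A B \in unitmx /\
  forall (t : 'I_N) j, t \notin sval I -> (pivot j < t)%N ->
    (invmx (walk_minor A B) *m candidate A B t.+1) j 0 = 0.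
Proof.
split=> [gw|[U H] t tN].
  have U : walk_minor A B \in unitmx by apply/free_emitted/greedy_free.
  split=> // t j tI jt.
  have := gw t (ltn_ord t); rewrite nat_mem_ord (negPf tI) => /esym/negbFE.
  by move=> /(mem_emitted _ _ _ (ltn_ord t)) [c -> c0]; rewrite mulKmx // c0 // ltnW.
pose c := Ordinal tN; rewrite -[t]/(val c) nat_mem_ord.
apply/idP/idP => [|/negP mt].
  move=> /pivotP [l cl]; apply/negP => /(mem_emitted _ _ _ (ltn_ord c)) [v e v0].
  have : v l 0 = 0 by apply: v0; rewrite -cl.
  move: e; rewrite cl -col_walk_minor colE => /(congr1 (mulmx (invmx (walk_minor A B)))).
  rewrite !mulKmx // => <-; rewrite mxE !eqxx; exact/eqP/oner_neq0.
apply: contrapT => /negP cI; apply: mt; apply/(mem_emitted _ _ _ (ltn_ord c)).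
exists (invmx (walk_minor A B) *m candidate A B c.+1); first by rewrite mulKVmx.
move=> j; rewrite ltnS leq_eqVlt => /orP[/eqP jc|jc]; last exact: H.
by move: cI; rewrite -(val_inj jc) pivot_in.
Qed.

(** The columns of A and B in the order of the walk: after the kept vector number j,
which is the j-th basis vector in a canonical form, A maps it to the next vector
read, column j of A; after a discarded vector a column of B is read. *)
Definition walk_col A B (t : nat) : 'cV[F]_n :=
  if [pick j | val (pivot j) == t] is Some j then col j A else input B (skips t).

Definition walk_mx A B : 'M[F]_(n, 1 + N) := \matrix_(i, t) walk_col A B t i 0.

(** The inverse of the sorting of columns. *)
Definition unwalk_A (X : 'M[F]_(n, 1 + N)) : 'M[F]_n :=
  \matrix_(i, j) X i (inord (pivot j)).

Definition unwalk_B (X : 'M[F]_(n, 1 + N)) : 'M[F]_(n, m) :=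
  \matrix_(i, k) if [pick t : 'I_N.+1 | ~~ w t && (skips t == k)] is Some t
                 then X i t else 0.

Lemma walk_col_pivot A B j : walk_col A B (pivot j) = col j A.
Proof.
rewrite /walk_col; case: pickP => [l /eqP /val_inj /pivot_inj -> //|/(_ j)].
by rewrite eqxx.
Qed.

Lemma walk_col_input A B t : ~~ w t -> walk_col A B t = input B (skips t).
Proof.
rewrite /walk_col; case: pickP => // j /eqP <-.
by rewrite nat_mem_pivot.
Qed.

(** If the kept vectors form the standard basis, then the vectors read are columns of
A and B.  It is enough to know this basis property either for the vectors read or
for the sorted columns, since the induction shows that they agree. *)
Lemma candidate_walk_col A B t : (forall j, candidate A B (pivot j).+1 = delta_mx j 0 \/
    walk_col A B (pivot j).+1 = delta_mx j 0) -> (t <= N)%N ->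
  candidate A B t = walk_col A B t.
Proof.
move=> H; move: t; apply: downward_ind => [|t tN IH].
  by rewrite candidateN walk_col_input ?skipsN //; apply/negP => /nat_mem_lt; rewrite ltnn.
rewrite candidateS //; case: ifP => [/nat_memP [j tj]|/negbT nt]; last by rewrite walk_col_input.
have -> : candidate A B t.+1 = delta_mx j 0.
  by have := H j; rewrite -tj -IH => -[].
by rewrite -colE tj walk_col_pivot.
Qed.

Lemma rsub_walk_mx A B i c : rsubmx (walk_mx A B) i c = walk_col A B c.+1 i 0.
Proof. by rewrite !mxE. Qed.

Lemma canonical_minor A B : echelon I (rsubmx (walk_mx A B)) -> walk_minor A B = 1%:M.
Proof.
move=> [E _]; have H j : walk_col A B (pivot j).+1 = delta_mx j 0.
  apply/colP => i; rewrite -rsub_walk_mx.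
  by have /matrixP/(_ i j) := E; rewrite mxE => ->; rewrite !mxE eqxx andbT.
apply/matrixP => i j; rewrite mxE (@candidate_walk_col A B) => [|l|]; last exact: ltn_ord.
  by rewrite H !mxE eqxx andbT.
by right.
Qed.

Lemma walk_mx_minor1 A B : walk_minor A B = 1%:M ->
  forall i c, rsubmx (walk_mx A B) i c = candidate A B c.+1 i 0.
Proof.
move=> M1 i c; rewrite rsub_walk_mx -candidate_walk_col //.
by move=> j; left; rewrite -col_walk_minor M1 col1.
Qed.

Lemma walk_minor_mul g A B : g \in unitmx ->
  walk_minor (g *m A *m invmx g) (g *m B) = g *m walk_minor A B.
Proof.
move=> gU; apply/matrixP => i j; rewrite mxE candidate_mul //.
by rewrite -col_walk_minor !mxE; apply: eq_bigr => k _; rewrite !mxE.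
Qed.

(** Conjugating by the inverse of the minor makes the kept vectors the standard
basis; the condition of [greedyP] on the discarded ones then says that the
sorted columns are in echelon form. *)
Lemma greedy_canonical A B (g := invmx (walk_minor A B)) : greedy N w A B <->
  walk_minor A B \in unitmx /\
  echelon I (rsubmx (walk_mx (g *m A *m invmx g) (g *m B))).
Proof.
rewrite greedyP; have [U|nU] := boolP (walk_minor A B \in unitmx); last by split=> -[].
have gU : g \in unitmx by rewrite unitmx_inv.
have M1 : walk_minor (g *m A *m invmx g) (g *m B) = 1%:M.
  by rewrite walk_minor_mul // mulVmx.
have E j (c : 'I_N) : rsubmx (walk_mx (g *m A *m invmx g) (g *m B)) j c =
    (g *m candidate A B c.+1) j 0.
  by rewrite walk_mx_minor1 // candidate_mul // ltn_ord.
split=> -[_ H]; split=> //.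
  split=> [|j c cI jc]; last by rewrite E H.
  apply/matrixP => i j; rewrite mxE E -col_walk_minor colE mulmxA mulVmx // mul1mx.
  by rewrite !mxE eqxx andbT.
by move=> t j tI jt; rewrite -E; exact: H.2.
Qed.

Lemma skips_lt t : (t <= N)%N -> (skips t < m)%N.
Proof.
move=> tN; rewrite -(skips_nat_mem I Nmn) ltnS /skips subn0.
rewrite -[X in iota 0 X](subnKC tN) iotaD count_cat add0n.
exact: leq_addl.
Qed.

(** The index of the current column of B goes up with every discarded vector, so no
column is read twice. *)
Lemma skips_inj t u : (t <= N)%N -> (u <= N)%N -> ~~ w t -> ~~ w u ->
  skips t = skips u -> t = u.
Proof.
wlog tu : t u / (t < u)%N.
  move=> W tN uN wt wu e; case: (ltngtP t u) => // h; first exact: W.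
  by apply/esym/W.
move=> tN uN wt wu.
have -> : skips t = (count (predC w) (iota t (u - t)) + skips u)%N.
  rewrite /skips -{2}(subnKC (ltnW tu)) -count_cat -iotaD; congr (count _ (iota _ _)).
  by rewrite addnC addnBA ?(ltnW tu) // subnK.
rewrite -(subnSK tu) /= wt add1n addSn => /eqP.
by rewrite gtn_eqF // ltnS leq_addl.
Qed.

Lemma unwalkK X : walk_mx (unwalk_A X) (unwalk_B X) = X.
Proof.
apply/matrixP => i t; rewrite mxE.
have tN : (t <= N)%N by rewrite -ltnS.
have [/nat_memP [j tj]|nt] := boolP (w t).
  rewrite tj walk_col_pivot !mxE; congr (X i _); apply: val_inj.
  by rewrite /= inordK // ltnS -tj.
rewrite walk_col_input // /input; case: insubP => [k _ kE|]; last by rewrite skips_lt.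
rewrite !mxE; case: pickP => [u /andP[wu /eqP su]|/(_ t)]; last by rewrite nt kE eqxx.
have uN : (u <= N)%N by rewrite -ltnS.
congr (X i _); apply: val_inj; apply: (skips_inj uN tN wu nt). by rewrite su kE.
Qed.

Lemma walkK A B : unwalk_A (walk_mx A B) = A /\ unwalk_B (walk_mx A B) = B.
Proof.
split; apply/matrixP => i k; rewrite mxE.
  by rewrite mxE inordK ?walk_col_pivot ?mxE // ltnS ltnW.
case: pickP => [t /andP[wt /eqP st]|H].
  rewrite mxE walk_col_input // st /input; case: insubP => [l _ lk|/negP []//].
  by rewrite mxE (val_inj lk).
have [|u [/andP[_ uN] wu su]] := @skips_surj N w 0 k (leq0n N).
  by rewrite -ltnS (skips_nat_mem I Nmn).
have := H (Ordinal (uN : (u < N.+1)%N)); rewrite /= su eqxx andbT => /negbFE wu'.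
by move: wu; rewrite wu' (nat_mem_lt wu').
Qed.

Lemma minor_unit_controllable p (C : 'M[F]_(p, n)) A B :
  walk_minor A B \in unitmx -> completely_controllable (A, B, C).
Proof.
move=> U; apply: controllable_ker0 => u H.
suff u0 : u *m walk_minor A B = 0.
  by rewrite -[u](mulmxK U) u0 mul0mx.
apply/rowP => j; rewrite [RHS]mxE.
have -> : (u *m walk_minor A B) 0 j = (u *m candidate A B (pivot j).+1) 0 0.
  rewrite -col_walk_minor [LHS]mxE [RHS]mxE; apply: eq_bigr => k _.
  by congr *%R; rewrite [RHS]mxE.
have [r rn [k ->]] := candidate_power w A B (ltn_ord (pivot j)).
have rn' : (r < n)%N.
  rewrite -[X in (_ < X)%N](count_nat_mem I) -[X in iota 0 X](subnKC (ltnW (ltn_ord (pivot j)))).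
  rewrite iotaD count_cat add0n -(subnSK (ltn_ord (pivot j))) /= nat_mem_pivot.
  by rewrite add1n addnS ltnS (leq_trans rn) ?leq_addl.
rewrite /input; case: insubP => [l _ _|_]; last by rewrite !mulmx0 mxE.
by rewrite (H (Ordinal rn') l) mxE.
Qed.

End CanonicalForms.

(** * The action of GL_n and the quotient map *)
Section Action.
Context {F : fieldType} {m n p : nat}.
Implicit Types (S : system F m n p) (g h : 'M[F]_n).

Lemma gl_actE g S :
  gl_act g S = (g *m S.1.1 *m invmx g, g *m S.1.2, S.2 *m invmx g).
Proof. by case: S => -[]. Qed.

Lemma gl_act1 S : gl_act 1%:M S = S.
Proof. by case: S => -[A B] C /=; rewrite invmx1 !mulmx1 !mul1mx. Qed.

Lemma gl_act_comp g h S : g \in unitmx -> h \in unitmx ->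
  gl_act g (gl_act h S) = gl_act (g *m h) S.
Proof. by move=> gU hU; rewrite !gl_actE /= invmx_mul // !mulmxA. Qed.

Lemma mem_gl_orbit g S : g \in unitmx -> gl_orbit S (gl_act g S).
Proof. by move=> gU; exists g. Qed.

Lemma gl_orbit_refl S : gl_orbit S S.
Proof. by exists 1%:M; rewrite ?gl_act1 //= unitmx1. Qed.

Lemma gl_orbit_act g S : g \in unitmx -> gl_orbit (gl_act g S) = gl_orbit S.
Proof.
move=> gU; apply/seteqP; split=> _ [h /= hU <-].
  by rewrite gl_act_comp //; apply: mem_gl_orbit; rewrite unitmx_mul hU.
have ->: gl_act h S = gl_act (h *m invmx g) (gl_act g S).
  by rewrite gl_act_comp ?unitmx_mul ?unitmx_inv ?hU // mulmxKV.
by apply: mem_gl_orbit; rewrite unitmx_mul unitmx_inv hU.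
Qed.

Definition cc_system (S : system F m n p) (cc : completely_controllable S) : Vcc F m n p :=
  exist (@completely_controllable F m n p) S cc.

Definition orbit_of (S : Vcc F m n p) : cc_orbits F m n p :=
  exist _ (gl_orbit (sval S)) (ex_intro2 _ _ _ (svalP S) erefl).

Lemma orbit_of_surj (O : cc_orbits F m n p) : exists x, orbit_of x = O.
Proof.
case: O => O [S cc OE]; by exists (cc_system cc); apply: eq_exist.
Qed.

Lemma orbit_of_eq (S S' : Vcc F m n p) : orbit_of S = orbit_of S' <->
  exists2 g, g \in unitmx & sval S' = gl_act g (sval S).
Proof.
split=> [/(congr1 sval) /= e|[g gU e]].
  by have := gl_orbit_refl (sval S'); rewrite -e => -[g gU <-]; exists g.
by apply: eq_exist; rewrite e gl_orbit_act.
Qed.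

End Action.

(** * The cells of the moduli space *)
Section SystemCells.
Context {F : fieldType} {m n p N : nat} (I : nsubset n N).
Context (Nmn : N.+1 = (m + n)%N).
Local Notation w := (nat_mem I).
Local Notation V := (system F m n p).
Local Notation W := (('rV[F]_#|free_entries I| * 'cV[F]_n * 'M[F]_(p, n))%type).
Implicit Types S : V.

Definition system_cell : set (syscc F m n p) :=
  [set O | exists2 S, sval O S & greedy N w S.1.1 S.1.2].

Lemma greedy_act g S : g \in unitmx -> greedy N w S.1.1 S.1.2 ->
  greedy N w (gl_act g S).1.1 (gl_act g S).1.2.
Proof. by move=> gU; rewrite gl_actE; exact: greedy_mul. Qed.

Lemma system_cellE (S : Vcc F m n p) :
  system_cell (orbit_of S) <-> greedy N w (sval S).1.1 (sval S).1.2.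
Proof.
split=> [[_ [g gU <-]]|gS]; last by exists (sval S) => //; exact: gl_orbit_refl.
rewrite /= in gU => /(greedy_act (g := invmx g)).
by rewrite unitmx_inv gl_act_comp ?unitmx_inv // mulVmx // gl_act1; apply.
Qed.

Let minor S := walk_minor I S.1.1 S.1.2.
Let U : set (affine V) := [set S | minor S \in unitmx].
Let normalize S := gl_act (invmx (minor S)) S.

(** A canonical form consists of an echelon matrix, the column read after the last
decision, which is unconstrained, and the output matrix. *)
Definition canonical_param (t : W) : V :=
  let X := row_mx t.1.2 (echelon_param t.1.1) in
  (unwalk_A I X, unwalk_B I X, t.2).

Definition canonical_coord (S : V) : W :=
  let X := walk_mx I S.1.1 S.1.2 in (echelon_coord I (rsubmx X), lsubmx X, S.2).

Fact walk_mx_linear a (A A' : 'M[F]_n) (B B' : 'M[F]_(n, m)) :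
  walk_mx I (a *: A + A') (a *: B + B') = a *: walk_mx I A B + walk_mx I A' B'.
Proof.
apply/matrixP => i t; rewrite !mxE /walk_col; case: pickP => [j _|_]; first by rewrite !mxE.
by rewrite /input; case: insubP => [k _ _|_]; rewrite !mxE // mulr0 addr0.
Qed.

Fact canonical_coord_linear : linear canonical_coord.
Proof.
move=> a S S'; rewrite /canonical_coord [(_ + _).1]/= [(_ + _).2]/=.
rewrite walk_mx_linear; congr (_, _, _).
  by rewrite -[RHS](linearP (echelon_coord I)) /= linearP.
by rewrite linearP.
Qed.

HB.instance Definition _ := GRing.isLinear.Build _ _ _ _ canonical_coord canonical_coord_linear.

Lemma walk_mx_param t : walk_mx I (canonical_param t).1.1 (canonical_param t).1.2 =
  row_mx t.1.2 (echelon_param t.1.1).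
Proof. exact: unwalkK. Qed.

Lemma canonical_paramK : cancel canonical_param canonical_coord.
Proof.
move=> t; rewrite /canonical_coord walk_mx_param row_mxKl row_mxKr echelon_paramK.
by case: t => -[].
Qed.

Lemma canonical_paramP S : canonical_param (canonical_coord S) = S <->
  echelon I (rsubmx (walk_mx I S.1.1 S.1.2)).
Proof.
split=> [<-|/echelon_paramP e].
  by rewrite walk_mx_param row_mxKr; exact: echelon_param_echelon.
have [AE BE] := walkK I Nmn S.1.1 S.1.2.
rewrite /canonical_param /canonical_coord /= e hsubmxK AE BE.
by case: S {e AE BE} => -[].
Qed.

Lemma canonical_param_minor t : minor (canonical_param t) = 1%:M.
Proof.
by apply: canonical_minor; apply/canonical_paramP; rewrite canonical_paramK.
Qed.

Let oW : open [set: affine W] := openT.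
Let oV : open [set: affine V] := openT.

Lemma canonical_param_regular : @regular_map F (affine W) setT V canonical_param.
Proof.
have r1 := @regular_map_id F W.
have r11 := regular_map_fst oW (regular_map_fst oW r1).
have r12 := regular_map_snd oW (regular_map_fst oW r1).
have rX : @regular_map F (affine W) setT _
    (fun t : W => row_mx t.1.2 (@echelon_param F _ _ I t.1.1)).
  apply/regular_map_mx => // i j; case: (split_ordP j) => k ->.
    apply: (@regular_ext _ (affine W) _ (fun t : W => t.1.2 i k)) => //.
      by move=> t _; rewrite row_mxEl.
    exact: (regular_map_mx _ oW).1 r12 i k.
  apply: (@regular_ext _ (affine W) _ (fun t : W => @echelon_param F _ _ I t.1.1 i k)) => //.
    by move=> t _; rewrite row_mxEr.
  apply: (regular_map_mx _ oW).1 i k.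
  apply: morphism_regular_map.
  apply: (morphism_comp (X := affine W) (Y := affine _)); last first.
    exact: morphism_affine (@echelon_param_regular F _ _ I).
  exact: morphism_affine r11.
have rX' := (regular_map_mx _ oW).1 rX.
apply: regular_map_pair => //; last exact: regular_map_snd r1.
apply: regular_map_pair => //; apply/regular_map_mx => // i j.
  apply: regular_ext (rX' i (inord (pivot I j))) => // t _.
  by rewrite [RHS]mxE.
case E : [pick u : 'I_N.+1 | ~~ w u && (skips N w u == j)] => [u|].
  by apply: regular_ext (rX' i u) => // t _; rewrite [RHS]mxE E.
by apply: regular_ext (regular_cst 0 oW) => // t _; rewrite [RHS]mxE E.
Qed.

Lemma candidate_regular t : @regular_map F (affine V) setT _
  (fun S : V => candidate N w S.1.1 S.1.2 t).
Proof.
have r1 := @regular_map_id F V.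
have rA := regular_map_fst oV (regular_map_fst oV r1).
have rB := regular_map_snd oV (regular_map_fst oV r1).
have rin k : @regular_map F (affine V) setT _ (fun S : V => input S.1.2 k).
  rewrite /input; case: insubP => [l _ _|_]; last exact: regular_map_cst.
  apply/regular_map_mx => // i j.
  apply: regular_ext ((regular_map_mx _ oV).1 rB i l) => // S _.
  by rewrite mxE.
rewrite /candidate; elim: (N - t)%N => [|s IH]; first exact: rin.
rewrite /=; case: (w _); last exact: rin.
exact: regular_map_mulmx rA IH.
Qed.

Lemma minor_regular : @regular_map F (affine V) setT _ minor.
Proof.
apply/regular_map_mx => // i j.
apply: regular_ext ((regular_map_mx _ oV).1 (@candidate_regular (pivot I j).+1) i 0) => //.
by move=> S _; rewrite mxE.
Qed.

Let U_open : open U.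
Proof.
have := regular_nz oV (regular_det oV minor_regular).
rewrite setTI; congr (open _); apply/seteqP.
by split=> S; rewrite /U /= unitmxE unitfE.
Qed.

Let normalize_regular : @regular_map F (affine V) U _ normalize.
Proof.
have s : U `<=` setT by [].
have rM := regular_map_restr U_open s minor_regular.
have r1 := regular_map_restr U_open s (@regular_map_id F V).
have rA := regular_map_fst U_open (regular_map_fst U_open r1).
have rB := regular_map_snd U_open (regular_map_fst U_open r1).
have rC := regular_map_snd U_open r1.
have rg := regular_map_invmx U_open (fun S h => h) rM.
apply: (@regular_map_ext F (affine V) _ _ (fun S : V => (invmx (minor S) *m S.1.1 *m minor S,
   invmx (minor S) *m S.1.2, S.2 *m minor S))) => //.
  by move=> S _; rewrite /normalize gl_actE invmxK.
apply: regular_map_pair => //; last exact: regular_map_mulmx.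
apply: regular_map_pair => //; last exact: regular_map_mulmx.
by do 2 apply: regular_map_mulmx => //.
Qed.

Let minor_act g S : g \in unitmx -> minor (gl_act g S) = g *m minor S.
Proof. by move=> gU; rewrite /minor gl_actE; exact: walk_minor_mul. Qed.

Let norm_inv (S S' : Vcc F m n p) : orbit_of S = orbit_of S' -> U (sval S) ->
  U (sval S') /\ normalize (sval S) = normalize (sval S').
Proof.
move=> /orbit_of_eq [g gU ->] US; rewrite /U /normalize /= minor_act //.
rewrite unitmx_mul gU US; split=> //.
by rewrite gl_act_comp ?unitmx_inv ?unitmx_mul ?gU // invmx_mul // mulmxKV.
Qed.

Let norm_fib (S S' : Vcc F m n p) : U (sval S) -> sval S' = normalize (sval S) ->
  orbit_of S' = orbit_of S.
Proof.
move=> US e; apply/esym/orbit_of_eq.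
by exists (invmx (minor (sval S))); rewrite ?unitmx_inv.
Qed.

Let param_U t : U (canonical_param t).
Proof. by rewrite /U /= canonical_param_minor unitmx1. Qed.

Let param_norm t : normalize (canonical_param t) = canonical_param t.
Proof. by rewrite /normalize canonical_param_minor invmx1 gl_act1. Qed.

Let param_cc t : completely_controllable (canonical_param t).
Proof. exact/minor_unit_controllable/param_U. Qed.

Let cellE (S : Vcc F m n p) : system_cell (orbit_of S) <->
  U (sval S) /\ canonical_param (canonical_coord (normalize (sval S))) = normalize (sval S).
Proof.
rewrite system_cellE greedy_canonical canonical_paramP /normalize gl_actE.
by [].
Qed.

Lemma system_cell_locally_closed : locally_closed system_cell.
Proof.
exact: (slice_locally_closed orbit_of_surj U_open normalize_regular norm_inv
  canonical_param_regular cellE).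
Qed.

Lemma system_cell_isomorphic : fs_isomorphic (fs_sub system_cell) (affine W).
Proof.
exact: (slice_isomorphic orbit_of_surj U_open normalize_regular norm_inv norm_fib
  canonical_param_regular param_cc param_U param_norm canonical_paramK cellE).
Qed.

Lemma system_cell_nonempty : system_cell !=set0.
Proof.
exists (orbit_of (cc_system (param_cc 0))); apply/cellE; split; first exact: param_U.
change (canonical_param (canonical_coord (normalize (canonical_param 0))) =
  normalize (canonical_param 0)).
by rewrite param_norm canonical_paramK.
Qed.

End SystemCells.

(** * The cell decomposition *)
Section SystemDecomposition.
Context {F : fieldType} {m n p N : nat}.

Lemma system_cell_disjoint (I J : nsubset n N) (O : syscc F m n p) :
  system_cell I O -> system_cell J O -> I = J.
Proof.
case: (orbit_of_surj O) => S <- /system_cellE gI /system_cellE gJ.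
apply: val_inj; apply/setP => i; rewrite -!nat_mem_ord.
exact: (greedy_uniq gI gJ).
Qed.

Lemma system_cell_cover (O : syscc F m n p) : N.+1 = (m + n)%N ->
  exists I : nsubset n N, system_cell I O.
Proof.
move=> Nmn; case: (orbit_of_surj O) => -[[[A B] C] cc] <-.
have [w gw] := greedy_ex N A B.
have cn : count w (iota 0 N) = n.
  rewrite -(greedy_count Nmn gw (fun Z => @controllable_stable_full F m n p A B C Z cc)).
  by rewrite size_map size_filter subn0.
pose I := [set c : 'I_N | w c]%SET.
have cI : #|I| == n.
  rewrite -cn -val_enum_ord count_map cardE size_filter -enumT.
  by apply/eqP/eq_count => c; rewrite /= inE.
exists (exist (fun I : {set 'I_N} => #|I| == n) I cI); apply/system_cellE.
apply: greedy_agree gw => t tN.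
by rewrite -[t]/(val (Ordinal tN)) nat_mem_ord /= inE.
Qed.

(** The dimension is dim S_I + n + pn, the terms coming from the three components of
a canonical form. *)
Lemma system_cells : N.+1 = (m + n)%N ->
  cell_decomposition (@system_cell F m n p N) (natural_dim (n := n) (N := N) ((p + 1) * n)).
Proof.
move=> Nmn; split=> [|I|I].
- split.
  + apply/seteqP; split=> // O _.
    by have [I OI] := system_cell_cover O Nmn; exists I.
  + by move=> I J _ _ [O [OI OJ]]; exact: system_cell_disjoint OI OJ.
  + by move=> I _; exact: system_cell_nonempty.
- exact: system_cell_locally_closed.
- apply: fs_isomorphic_trans (affine_isomorphic _); first exact: system_cell_isomorphic.
  rewrite !dim_pair !dim_mx !mul1n muln1 /natural_dim card_free_entries.
  by rewrite mulnDl mul1n [(p * n + n)%N]addnC addnA.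
Qed.

End SystemDecomposition.

(** For m = n = 0 the truncated m + n - 1 is 0 instead of -1, so N + 1 = m + n fails;
but then both spaces are points. *)
Lemma zero_system_cells (F : fieldType) (p : nat) :
  cell_decomposition (fun _ : nsubset 0 0 => [set: syscc F 0 0 p])
    (natural_dim (n := 0) (N := 0) ((p + 1) * 0)).
Proof.
have one (S S' : system F 0 0 p) : S = S'.
  case: S S' => -[A B] C [[A' B'] C'].
  have mx0 a (X Y : 'M[F]_(a, 0)) : X = Y by apply/matrixP => i [].
  by rewrite (mx0 _ A A') (mx0 _ B B') (mx0 _ C C').
have [O0 O0P] : exists O0 : syscc F 0 0 p, forall O, O = O0.
  have cc0 : @completely_controllable F 0 0 p (0, 0, 0).
    by have := rank_leq_row (@ctrl_mx F 0 0 p (0, 0, 0)); rewrite leqn0 => /eqP.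
  exists (orbit_of (cc_system cc0)) => O.
  case: (orbit_of_surj O) => -[S cc] <-; congr orbit_of; apply: eq_exist; exact: one.
split=> [|I|I].
- split.
  + apply/seteqP; split=> // O _.
    have c0 : #|finset.set0 : {set 'I_0}| == 0%N by rewrite cards0.
    by exists (exist (fun I : {set 'I_0} => #|I| == 0%N) _ c0).
  + by move=> I J _ _ _; apply: val_inj; apply/setP => -[].
  + by move=> I _; exists O0.
- exists setT, setT; split; [exact: openT|exact: closedT|by rewrite setTI].
- apply: one_point_affine.
    exists (exist setT O0 Logic.I) => -[O h]; apply: eq_exist; exact: O0P.
  by rewrite /natural_dim muln0 addn0 /schubert_dim big1 // => -[].
Qed.

Theorem theorem3 (R : realType) (m n p : nat) :
  exists E : vbundle (Gras R[i]%C n (m + n - 1)) ((p + 1) * n),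
    cell_decomposition (natural_cell (E := E))
      (natural_dim (n := n) (N := m + n - 1) ((p + 1) * n)) /\
    exists (K : finType) (cell : K -> set (syscc R[i]%C m n p)) (d : K -> nat),
      cell_decomposition cell d /\
      identical_cells d (natural_dim (n := n) (N := m + n - 1) ((p + 1) * n)).
Proof.
exists (trivial_bundle (Gras R[i]%C n (m + n - 1)) ((p + 1) * n)).
split; first exact: trivial_bundle_cells.
have idc (d : nsubset n (m + n - 1) -> nat) : identical_cells d d.
  by exists id => //; exists id.
have [|mn] := posnP (m + n).
  move=> /eqP; rewrite addn_eq0 => /andP[/eqP m0 /eqP n0].
  move: idc; subst m n => idc.
  by eexists _, _, _; split; [exact: zero_system_cells|exact: idc].
exists (nsubset n (m + n - 1)); exists (@system_cell _ m n p (m + n - 1)).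
exists (natural_dim (n := n) (N := m + n - 1) ((p + 1) * n)).
split; last exact: idc.
by apply: system_cells; rewrite subn1 prednK.
Qed.
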